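(* Let $f:\mathbb{C}\to\mathbb{C}$ be given by $f(z)=z+1+e^{-z}$. Then, for every $m\in\mathbb{N}$, the set $$I(f,((n+m)/2))=\left\{z\in\mathbb{C}: |f^n(z)|\geq \frac{n+m}{2}\ \text{ for all } n\in\mathbb{N}\right\}$$ contains a spider's web.
   Context: $f^n$ denotes the $n$th iterate of $f$, and $\mathbb{N}=\{1,2,\dots\}$. A set $E\subset\mathbb{C}$ is an (infinite) spider's web if $E$ is connected and there exists a sequence $(G_n)_{n\in\mathbb{N}}$ of bounded simply connected domains with $G_n\subset G_{n+1}$ and $\partial G_n\subset E$ for all $n\in\mathbb{N}$, and $\bigcup_{n\in\mathbb{N}}G_n=\mathbb{C}$. ''A set contains a spider's web'' means that it has a subset which is a spider's web. *)

(* Defs.v *)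
From HB Require Import structures.
From mathcomp Require Import all_boot all_order all_algebra.
From mathcomp Require Import all_classical all_reals all_analysis.
From mathcomp Require Import complex.

Set Implicit Arguments.
Unset Strict Implicit.
Unset Printing Implicit Defensive.

Import Order.TTheory GRing.Theory Num.Theory.
Import numFieldNormedType.Exports.

Local Open Scope classical_set_scope.
Local Open Scope ring_scope.
Local Open Scope complex_scope.

(* The regular module [R[i]^o] is the copy of [R[i]] that carries the topology
   of the modulus. As in any [numClosedFieldType], [`|z|] is a (real) element
   of [R[i]], and [x <= y] means that [y - x] is a nonnegative real. *)
Notation C R := (R[i]^o).

(* exp (x + iy) = exp x * (cos y + i sin y) *)
Definition cexp (R : realType) (z : C R) : C R :=
  (expR (complex.Re z))%:C * (cos (complex.Im z) +i* sin (complex.Im z)).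

Lemma cexp_real (R : realType) (x : R) : cexp x%:C = (expR x)%:C.
Proof. by rewrite /cexp /= cos0 sin0 mulr1. Qed.

Lemma cexpD (R : realType) (z w : C R) : cexp (z + w) = cexp z * cexp w.
Proof.
case: z w => [a b] [c d]; rewrite /cexp /= expRD cosD sinD.
rewrite rmorphM /= mulrACA; congr (_ * _).
by apply/eqP; rewrite eq_complex /= addrC [X in _ && (_ == X)]addrC !eqxx.
Qed.

Definition boundary (T : topologicalType) (A : set T) : set T :=
  closure A `\` A°.

Section SimplyConnected.
Variables (R : realType) (T : topologicalType).

Definition is_loop_in (G : set T) (gamma : R -> T) : Prop :=
  [/\ {within `[0, 1], continuous gamma},
      gamma @` `[0, 1] `<=` G
    & gamma 0 = gamma 1].

(* [H (s, t)] is a homotopy through closed curves in [G], with [s] the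
   deformation parameter and [t] the parameter of the curves. *)
Definition null_homotopic_in (G : set T) (gamma : R -> T) : Prop :=
  exists H : R * R -> T,
    [/\ {within `[0, 1] `*` `[0, 1], continuous H},
        H @` (`[0, 1] `*` `[0, 1]) `<=` G,
        {in `[0, 1], forall t, H (0, t) = gamma t},
        {in `[0, 1], forall s, H (s, 0) = H (s, 1)}
      & exists c : T, {in `[0, 1], forall t, H (1, t) = c}].

Definition simply_connected_domain (G : set T) : Prop :=
  [/\ G !=set0, open G, connected G
    & forall gamma, is_loop_in G gamma -> null_homotopic_in G gamma].

End SimplyConnected.

Definition spiders_web (R : realType) (E : set (C R)) : Prop :=
  connected E /\
  exists G : nat -> set (C R),
    [/\ forall n, bounded_set (G n) /\ simply_connected_domain R (G n),
        forall n, G n `<=` G n.+1,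
        forall n, boundary (G n) `<=` E
      & \bigcup_n G n = setT].

Definition contains_spiders_web (R : realType) (A : set (C R)) : Prop :=
  exists E : set (C R), E `<=` A /\ spiders_web E.

(* I(f, (a_n)); the iterates are indexed by n >= 1. *)
Definition escaping_set_at_rate (R : realType) (f : C R -> C R) (a : nat -> R) :
    set (C R) :=
  [set z | forall n, (0 < n)%N -> (a n)%:C <= `|iter n f z|].

Definition fatou_map (R : realType) (z : C R) : C R := z + 1 + cexp (- z).

(* Main.v *)
Require Import Defs.
From mathcomp Require Import all_boot all_order all_algebra.
From mathcomp Require Import all_classical all_reals all_analysis.
From mathcomp Require Import complex ring lra.

(** The web is built from squares of half-side S_n, where
S_n is a multiple of 2 pi comparable to exp S_(n-1). On the lines
Im z = S_n, which f preserves, and on Re z >= S_0 the orbits are fast enough,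
so only the left sides of the squares have to be replaced. There f is close to
z |-> exp (-z), and the left part of the domain G_n is obtained by pulling
G_(n+1) back under f: G_n consists of the points that some iterate f^k maps
into the open square of level n+k before they leave the bands. A boundary
point of G_n is then good for an elementary reason or is mapped into the
boundary of G_(n+1), so the moduli along its orbit stay above the S_(n+k).

On the strips of height pi around the odd multiples of i pi one has
Re f' >= 1, so f is injective and expanding there, with a continuous inverse.
Lifting deformations through these inverses retracts G_n onto a
square, so G_n is simply connected, although its boundary is complicated.
Connectedness of the web comes from nested compact sets K_(n,k): each strip
contains an inverse image of K_(n+1,k), joined by explicit preimages of the
lines Im z = +-S_(n+1) to the lines Im z = 2 pi j. *)

Set Implicit Arguments.
Unset Strict Implicit.
Unset Printing Implicit Defensive.

Import Order.TTheory GRing.Theory Num.Theory.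
Import numFieldNormedType.Exports.

Local Open Scope classical_set_scope.
Local Open Scope ring_scope.
Local Open Scope complex_scope.

Local Notation re := complex.Re.
Local Notation im := complex.Im.

(** * The complex plane and the real and imaginary parts of f *)

Section ComplexPlane.
Variable R : realType.
Implicit Types (z w : C R) (x y : R).

Lemma cvgC (T : Type) (F : set_system T) (FF : Filter F) (g : T -> C R) z :
  re (g t) @[t --> F] --> re z -> im (g t) @[t --> F] --> im z ->
  g t @[t --> F] --> z.
Proof.
move=> cr ci; apply/cvgrPdist_lt => -[e e'] e0.
have := e0; rewrite ltcE /= => /andP[/eqP e'0 e1]; subst e'.
move/cvgrPdist_lt: cr => /(_ (e / 2)); rewrite divr_gt0// => /(_ isT) cr.
move/cvgrPdist_lt: ci => /(_ (e / 2)); rewrite divr_gt0// => /(_ isT) ci.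
near=> t.
have h1 : `|re z - re (g t)| < e / 2 by near: t.
have h2 : `|im z - im (g t)| < e / 2 by near: t.
have -> : z - g t = (re z - re (g t)) +i* (im z - im (g t)).
  by case: (z) => ? ?; case: (g t).
rewrite normc_def /= (_ : e +i* 0 = e%:C)// ltcR.
rewrite -[ltRHS]ger0_norm ?ltW// -sqrtr_sqr ltr_sqrt ?exprn_gt0//.
move: h1 h2; rewrite !ltr_norml => /andP[? ?] /andP[? ?]; nra.
Unshelve. all: by end_near. Qed.

Lemma continuous_re : continuous (@complex.Re R : C R -> R).
Proof.
move=> z; apply/(@cvgrPdist_lt R R^o _ (nbhs (z : C R)) _ (@complex.Re R)).
move=> e e0.
have e0' : 0 < e%:C by rewrite ltcR.
near=> w.
have : `|z - w| < e%:C by near: w; exact: cvgr_dist_lt.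
rewrite -ltcR; apply: le_lt_trans.
have -> : re z - re w = re (z - w) by case: (z); case: (w).
exact: normc_ge_Re.
Unshelve. all: by end_near. Qed.

Lemma continuous_im : continuous (@complex.Im R : C R -> R).
Proof.
move=> z; apply/(@cvgrPdist_lt R R^o _ (nbhs (z : C R)) _ (@complex.Im R)).
move=> e e0.
have e0' : 0 < e%:C by rewrite ltcR.
near=> w.
have : `|z - w| < e%:C by near: w; exact: cvgr_dist_lt.
rewrite -ltcR; apply: le_lt_trans.
have -> : im z - im w = im (z - w) by case: (z); case: (w).
case: (z - w) => a b; rewrite normc_def /= lecR -sqrtr_sqr ler_wsqrtr//.
by rewrite lerDr sqr_ge0.
Unshelve. all: by end_near. Qed.

Lemma cvg_re (T : Type) (F : set_system T) (FF : Filter F) (g : T -> C R) z :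
  g t @[t --> F] --> z -> re (g t) @[t --> F] --> re z.
Proof.
by move=> gz; exact: (@cvg_comp _ _ _ g (@complex.Re R : C R -> R) F _ _ gz (@continuous_re z)).
Qed.

Lemma cvg_im (T : Type) (F : set_system T) (FF : Filter F) (g : T -> C R) z :
  g t @[t --> F] --> z -> im (g t) @[t --> F] --> im z.
Proof.
by move=> gz; exact: (@cvg_comp _ _ _ g (@complex.Im R : C R -> R) F _ _ gz (@continuous_im z)).
Qed.

Definition fatou_re (z : C R) : R := re z + 1 + expR (- re z) * cos (im z).
Definition fatou_im (z : C R) : R := im z - expR (- re z) * sin (im z).

Lemma fatouE z : fatou_map z = fatou_re z +i* fatou_im z.
Proof.
case: z => x y; rewrite /fatou_map /cexp /fatou_re /fatou_im /=.
apply/eqP; rewrite eq_complex /= cosN sinN.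
by apply/andP; split; apply/eqP; ring.
Qed.

Lemma re_fatou z : re (fatou_map z) = fatou_re z. Proof. by rewrite fatouE. Qed.
Lemma im_fatou z : im (fatou_map z) = fatou_im z. Proof. by rewrite fatouE. Qed.

Lemma cvg_fatou_re (T : Type) (F : set_system T) (FF : Filter F) (g : T -> C R) z :
  g t @[t --> F] --> z -> fatou_re (g t) @[t --> F] --> fatou_re z.
Proof.
move=> gz; apply: cvgD.
  by apply: cvgD; [exact: cvg_re|exact: cvg_cst].
apply: cvgM.
  by apply: continuous_cvg; [exact: continuous_expR|apply: cvgN; exact: cvg_re].
by apply: continuous_cvg; [exact: continuous_cos|exact: cvg_im].
Qed.

Lemma cvg_fatou_im (T : Type) (F : set_system T) (FF : Filter F) (g : T -> C R) z :
  g t @[t --> F] --> z -> fatou_im (g t) @[t --> F] --> fatou_im z.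
Proof.
move=> gz; apply: cvgB; first exact: cvg_im.
apply: cvgM.
  by apply: continuous_cvg; [exact: continuous_expR|apply: cvgN; exact: cvg_re].
by apply: continuous_cvg; [exact: continuous_sin|exact: cvg_im].
Qed.

Lemma continuous_fatou_im : continuous fatou_im.
Proof. by move=> z; apply: (@cvg_fatou_im _ (nbhs z)) cvg_id. Qed.

Lemma cvg_fatou (T : Type) (F : set_system T) (FF : Filter F) (g : T -> C R) z :
  g t @[t --> F] --> z -> fatou_map (g t) @[t --> F] --> fatou_map z.
Proof.
move=> gz; apply: cvgC; rewrite ?re_fatou ?im_fatou.
  by under eq_fun do rewrite re_fatou; exact: cvg_fatou_re.
by under eq_fun do rewrite im_fatou; exact: cvg_fatou_im.
Qed.

Lemma continuous_fatou : continuous (@fatou_map R).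
Proof. by move=> z; apply: (@cvg_fatou _ (nbhs z)) cvg_id. Qed.

End ComplexPlane.

(** * Injectivity and surjectivity of f on strips *)

Section Estimates.
Variable R : realType.
Implicit Types (x y s t a b c r : R) (z w : C R).

(** Squares [1 + t / 2 <= expR (t / 2)]. This quadratic growth is enough to yield numerical facts
    such as [expR 16 >= 81]. *)
Lemma expR_ge_sqr t : 0 <= t -> (1 + t / 2) ^+ 2 <= expR t.
Proof.
move=> t0; have -> : expR t = expR (t / 2) ^+ 2.
  by rewrite -expRM_natl; congr expR; lra.
by rewrite lerXn2r ?nnegrE ?expR_ge0//; [lra|exact: expR_ge1Dx].
Qed.

(** Throughout, [cos c = -1] is how [c] is said to be an odd multiple of pi, the height of the
    central line of a strip. *)
Lemma cosD_center c s : cos c = -1 -> cos (c + s) = - cos s.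
Proof.
move=> c1; have s0 : sin c = 0 by apply: cos1sin0; rewrite c1 normrN1.
by rewrite cosD c1 s0; ring.
Qed.

Lemma sinD_center c s : cos c = -1 -> sin (c + s) = - sin s.
Proof.
move=> c1; have s0 : sin c = 0 by apply: cos1sin0; rewrite c1 normrN1.
by rewrite sinD c1 s0; ring.
Qed.

Lemma cos_nat_pi n : cos (2 * pi * n%:R) = 1 :> R.
Proof.
elim: n => [|n ih]; first by rewrite mulr0 cos0.
have -> : 2 * pi * n.+1%:R = 2 * pi * n%:R + pi *+ 2 :> R.
  by rewrite -natr1 -mulr_natl; ring.
by rewrite cosD2pi.
Qed.

Lemma cos_odd_pi n : cos (2 * pi * n%:R + pi) = -1 :> R.
Proof. by rewrite cosDpi cos_nat_pi. Qed.

(** The band of half-height [2 pi N] is tiled by intervals of radius pi around odd multiples of pi;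
    the induction peels off the outermost pair. *)
Lemma center_near N y : (0 < N)%N -> `|y| <= 2 * pi * N%:R ->
  exists i, (i < N)%N /\ exists c, (c = 2 * pi * i%:R + pi \/
    c = - (2 * pi * i%:R + pi)) /\ `|y - c| <= pi.
Proof.
have p0 := pi_gt0 R.
elim: N => // -[|N] ih _ yN.
  exists 0%N; split=> //; move: yN; rewrite ler_norml => /andP[y1 y2].
  have [y0|y0] := leP 0 y.
    exists pi; split; first by left; rewrite mulr0 add0r.
    by rewrite ler_norml; apply/andP; split; lra.
  exists (- pi); split; first by right; rewrite mulr0 add0r.
  by rewrite ler_norml; apply/andP; split; lra.
have [yN'|yN'] := leP `|y| (2 * pi * N.+1%:R).
  have [//|i [iN H]] := ih _ yN'.
  by exists i; split=> //; rewrite (ltn_trans iN).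
exists N.+1; split=> //.
have e : 2 * pi * N.+2%:R = 2 * pi * N.+1%:R + 2 * pi :> R.
  by rewrite -(natr1 N.+1); ring.
move: yN yN'; rewrite e; set q := 2 * pi * N.+1%:R.
have [y0|y0] := leP 0 y.
  rewrite ger0_norm// => y1 y2; exists (q + pi); split; first by left.
  by rewrite ler_norml; apply/andP; split; lra.
rewrite ltr0_norm// => y1 y2; exists (- (q + pi)); split; first by right.
by rewrite ler_norml; apply/andP; split; lra.
Qed.

(** The equation says [(t - s) / sin s = r], so this finds a point where that quotient takes a
    prescribed value. *)
Lemma solve_sin r t : 0 < r -> 0 < t -> t <= pi / 2 + r ->
  exists s, [/\ 0 < s, s <= pi / 2 & s + r * sin s = t].
Proof.
move=> r0 t0 tr; have p0 := pi_gt0 R.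
have [| | |s] := @IVT R (fun s => s + r * sin s) 0 (pi / 2) t.
- by lra.
- apply: continuous_subspaceT => s; apply: cvgD; first exact: cvg_id.
  by apply: cvgM; [exact: cvg_cst|exact: continuous_sin].
- rewrite sin0 sin_pihalf mulr0 mulr1 addr0 ge_min le_max.
  by apply/andP; split; apply/orP; [left|right]; lra.
rewrite in_itv/= => /andP[s0 s1] e; exists s; split=> //.
rewrite lt_neqAle s0 andbT; apply/eqP => s00; move: e.
by rewrite -s00 sin0 mulr0 addr0 => e; rewrite e ltxx in t0.
Qed.

(* Eliminating x leaves F s = a with r s = exp (-x) = (t - s) / sin s; the two
   bracketing points come from prescribing a large and a moderate value of r. *)
Lemma solve_strip_pos a b t : 0 <= b -> a <= - b -> 0 < t -> t <= 2 * b ->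
  exists x s, [/\ 0 < s, s <= pi / 2, x + 1 - expR (- x) * cos s = a
    & s + expR (- x) * sin s = t].
Proof.
move=> b0 ab t0 tb; have p0 := pi_gt0 R; have p2 := pi_ge2 R.
pose r s := (t - s) / sin s.
pose F s := 1 - ln (r s) - r s * cos s.
have sin_gt0 s : 0 < s -> s <= pi / 2 -> 0 < sin s.
  by move=> s0 s1; apply: sin_gt0_pi; lra.
have [s1 [s10 s1p s1t F1]] : exists s, [/\ 0 < s, s <= pi / 2, s < t & F s <= a].
  (* If [r s = q], then [q sin s <= t] forces [sin s <= 1/2], hence [cos s >= 1/2] and
     [F s <= 1 - q / 2 <= a]. *)
  pose q := 2 * (1 - a) + 2 * t + 1.
  have [| | |s [s0 sp e]] := @solve_sin q t; rewrite /q; try lra.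
  have sg := sin_gt0 s s0 sp.
  have st : s < t by rewrite -e ltrDl mulr_gt0// /q; lra.
  have rq : r s = q by rewrite /r -e /q; field; rewrite gt_eqF.
  exists s; split=> //; rewrite /F rq.
  have lq : 0 <= ln q by apply: ln_ge0; rewrite /q; lra.
  have cs : 0 <= cos s by apply: cos_ge0_pihalf; lra.
  have ss : sin s <= 1 / 2.
    have e' : q * sin s = t - s by rewrite -rq /r; field; rewrite gt_eqF.
    rewrite leNgt; apply/negP => h.
    have : q * (1 / 2) < q * sin s by rewrite ltr_pM2l// /q; lra.
    by rewrite e' /q; lra.
  have c2 := cos2Dsin2 s.
  have cs' : 1 / 2 <= cos s by nra.
  have : q * (1 / 2) <= q * cos s by rewrite ler_pM2l// /q; lra.
  by rewrite /q in lq *; lra.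
have [s2 [s20 s2p s2t F2]] : exists s, [/\ 0 < s, s <= pi / 2, s < t & a <= F s].
  (* For small [t], a point with [r s = 1] has [F s = 1 - cos s >= 0]. Otherwise [pi / 2] works: the
     cosine term vanishes there and [ln (2 b) <= b + 1]. *)
  have [tp|tp] := leP t (pi / 2 + 1).
    have [| | |s [s0 sp e]] := @solve_sin 1 t; try lra.
    have sg := sin_gt0 s s0 sp.
    have st : s < t by lra.
    have rq : r s = 1 by rewrite /r -e; field; rewrite gt_eqF.
    exists s; split=> //; rewrite /F rq ln1.
    by have := cos_le1 s; lra.
  exists (pi / 2); split; try lra.
  rewrite /F /r sin_pihalf cos_pihalf mulr0 divr1.
  suff : ln (t - pi / 2) <= b + 1 by lra.
  rewrite -[leRHS]expRK ler_ln ?posrE ?expR_gt0//; last lra.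
  have := @expR_ge_sqr (b + 1); nra.
have [s [s0 sp st Fs]] : exists s, [/\ 0 < s, s <= pi / 2, s < t & F s = a].
  pose u := Num.min s1 s2; pose v := Num.max s1 s2.
  have uv : u <= v by rewrite /u /v; case: (leP s1 s2) => // /ltW.
  have [] := @IVT R F u v a uv.
  - apply: continuous_in_subspaceT => s; rewrite inE/= in_itv/= => /andP[us sv].
    have s0 : 0 < s by rewrite (lt_le_trans _ us)// /u lt_min s10.
    have st : s < t by rewrite (le_lt_trans sv)// /v gt_max s1t.
    have sp : s <= pi / 2 by rewrite (le_trans sv)// /v ge_max s1p.
    have sg := sin_gt0 s s0 sp.
    have cr : r x @[x --> s] --> r s.
      apply: cvgM; first by apply: cvgB; [exact: cvg_cst|exact: cvg_id].
      by apply: cvgV; [rewrite gt_eqF|exact: continuous_sin].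
    apply: cvgB; last by apply: cvgM => //; exact: continuous_cos.
    apply: cvgB; first exact: cvg_cst.
    apply: continuous_cvg => //; apply: continuous_ln.
    by rewrite divr_gt0 ?subr_gt0.
  - by rewrite /u /v; case: (leP s1 s2) => _; rewrite ge_min le_max F1 F2 ?orbT.
  move=> s; rewrite in_itv/= => /andP[us sv] Fs; exists s; split=> //.
  + by rewrite (lt_le_trans _ us)// /u lt_min s10.
  + by rewrite (le_trans sv)// /v ge_max s1p.
  + by rewrite (le_lt_trans sv)// /v gt_max s1t.
have sg := sin_gt0 s s0 sp.
have rp : 0 < r s by rewrite divr_gt0 ?subr_gt0.
exists (- ln (r s)), s; rewrite opprK lnK ?posrE//; split=> //.
  by rewrite -Fs /F; lra.
by rewrite /r; field; rewrite gt_eqF.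
Qed.

(** The degenerate case of the strip equations on the central line, where the sine term vanishes. *)
Lemma solve_axis a : a <= 0 -> exists x, x + 1 - expR (- x) = a.
Proof.
move=> a0; have [| | |x _ e] := @IVT R (fun x => x + 1 - expR (- x)) a 0 a.
- by [].
- apply: continuous_subspaceT => x; apply: cvgB.
    by apply: cvgD; [exact: cvg_id|exact: cvg_cst].
  by apply: continuous_cvg; [exact: continuous_expR|apply: cvgN; exact: cvg_id].
- rewrite oppr0 expR0 ge_min le_max; apply/andP; split; apply/orP.
    by left; have := @expR_ge1Dx R (- a); lra.
  by right; lra.
by exists x.
Qed.

(** Reflection in the line [Im z = c] reduces the two sides of that line to [solve_strip_pos], with
    [t = |im w - c| <= 2 b]. *)
Lemma fatou_strip_surj b c w : 0 <= b -> cos c = -1 -> `|c| <= b ->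
  re w <= - b -> `|im w| <= b ->
  exists z, `|im z - c| <= pi / 2 /\ fatou_map z = w.
Proof.
move=> b0 cc cb wr wi; have p0 := pi_gt0 R.
have eqw (z : C R) : fatou_re z = re w -> fatou_im z = im w -> fatou_map z = w.
  by rewrite fatouE => -> ->; case: (w).
move: cb wi; rewrite !ler_norml => /andP[c1 c2] /andP[w1 w2].
have [h|h|h] := ltgtP (im w - c) 0.
- have [x [s [s0 sp e1 e2]]] := @solve_strip_pos (re w) b (c - im w) b0 wr
    ltac:(lra) ltac:(lra).
  exists (x +i* (c - s)); split=> /=; first by rewrite ler_norml; lra.
  apply: eqw; rewrite /fatou_re /fatou_im /= ?(cosD_center (- s) cc) ?(sinD_center (- s) cc).
    by rewrite cosN -e1; ring.
  by rewrite sinN; lra.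
- have [x [s [s0 sp e1 e2]]] := @solve_strip_pos (re w) b (im w - c) b0 wr
    ltac:(lra) ltac:(lra).
  exists (x +i* (c + s)); split=> /=; first by rewrite ler_norml; lra.
  apply: eqw; rewrite /fatou_re /fatou_im /= ?(cosD_center s cc) ?(sinD_center s cc).
    by rewrite -e1; ring.
  by lra.
have [x e] := @solve_axis (re w) ltac:(lra).
exists (x +i* c); split=> /=; first by rewrite subrr normr0; lra.
have := sinD_center 0 cc; rewrite addr0 sin0 => sc.
by apply: eqw; rewrite /fatou_re /fatou_im /= ?cc ?sc; lra.
Qed.

(* Re f' = 1 - Re (exp (-z)) >= 1 on the strip, integrated along a segment. *)
Lemma fatou_strip_monotone c z w : cos c = -1 ->
  `|im z - c| <= pi / 2 -> `|im w - c| <= pi / 2 ->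
  (re z - re w) ^+ 2 + (im z - im w) ^+ 2 <=
  (re z - re w) * (fatou_re z - fatou_re w) + (im z - im w) * (fatou_im z - fatou_im w).
Proof.
case: z w => [x1 y1] [x0 y0] cc /=; rewrite !ler_norml => /andP[h1 h2] /andP[h3 h4].
have [p ep] : exists p, p = x1 - x0 by eexists.
have [q eq] : exists q, q = y1 - y0 by eexists.
(* [F] is the inner product of the displacement [(p, q)] with f at the point [t] of the segment; its
   derivative is [(p^2 + q^2) Re f']. *)
pose F t := p * (x0 + t * p + 1 + expR (- (x0 + t * p)) * cos (y0 + t * q)) +
  q * (y0 + t * q - expR (- (x0 + t * p)) * sin (y0 + t * q)).
pose dF t := (p ^+ 2 + q ^+ 2) * (1 - expR (- (x0 + t * p)) * cos (y0 + t * q)).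
have FD t : is_derive t 1 F (dF t).
  by rewrite /F; apply: is_derive_eq; rewrite /GRing.scale /= /dF; ring.
have cF : {within `[0, 1], continuous F}.
  by apply: derivable_within_continuous => t _; apply: (@ex_derive _ _ _ _ _ _ _ (FD t)).
have [t] := @MVT R F dF 0 1 ltr01 (fun t _ => FD t) cF.
rewrite in_itv/= => /andP[t0 t1].
rewrite subr0 mulr1 /F !mul1r !mul0r !addr0 => e.
rewrite /fatou_re /fatou_im /= -ep -eq.
have ct : cos (y0 + t * q) <= 0.
  have -> : y0 + t * q = c + (y0 + t * q - c) by ring.
  rewrite (cosD_center _ cc) oppr_le0; apply: cos_ge0_pihalf.
  have -> : y0 + t * q - c = (1 - t) * (y0 - c) + t * (y1 - c) by rewrite eq; ring.
  apply/andP; split.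
    have : 0 <= t * (y1 - c + pi / 2) by apply: mulr_ge0; lra.
    have : 0 <= (1 - t) * (y0 - c + pi / 2) by apply: mulr_ge0; lra.
    by lra.
  have : 0 <= t * (pi / 2 - (y1 - c)) by apply: mulr_ge0; lra.
  have : 0 <= (1 - t) * (pi / 2 - (y0 - c)) by apply: mulr_ge0; lra.
  by lra.
have et := expR_gt0 (- (x0 + t * p)).
have : p ^+ 2 + q ^+ 2 <= dF t.
  rewrite /dF -[leLHS]mulr1; apply: ler_wpM2l; first by rewrite addr_ge0 ?sqr_ge0.
  have : 0 <= expR (- (x0 + t * p)) * (- cos (y0 + t * q)) by rewrite mulr_ge0; lra.
  by lra.
rewrite -e; have -> : x0 + p = x1 by rewrite ep; ring.
have -> : y0 + q = y1 by rewrite eq; ring.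
move=> h; apply: (le_trans h).
set u := expR _ * cos y1; set u' := expR _ * cos y0.
set v := expR _ * sin y1; set v' := expR _ * sin y0.
by rewrite ep eq; lra.
Qed.

End Estimates.

(** * Fast orbits and scales *)

Section Scales.
Variable R : realType.
Implicit Types (x y s t a b c r : R) (z w : C R).

(** The lower bound on [b] places the image of the left edge of one square inside the next square;
    the upper bound expels points lying 16 units beyond that edge. *)
Definition scale a b := [/\ 12 <= a, 4 * expR a <= b & b <= 16 * expR a].

(** The threshold 12 is where [(1 + t / 2) ^ 2] overtakes [4 t + 1]. *)
Lemma expR_ge4 t : 12 <= t -> 4 * t + 1 <= expR t.
Proof. by move=> t12; have := @expR_ge_sqr R t; nra. Qed.

Lemma scale_gt a b : scale a b -> 16 * a < b.
Proof. by case=> a12 ab _; have := expR_ge4 a12; lra. Qed.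

Lemma norm_ge_re r z : r <= `|re z| -> r%:C <= `|z|.
Proof. by move=> h; apply: le_trans (normc_ge_Re z); rewrite lecR. Qed.

Lemma norm_ge_im r z : r <= `|im z| -> r%:C <= `|z|.
Proof.
case: z => x y /= h; rewrite normc_def lecR /=.
by rewrite (le_trans h)// -sqrtr_sqr ler_wsqrtr// lerDr sqr_ge0.
Qed.

(* The bound (k + m) / 2 along an orbit, read from time n on with a = n + m. *)
Definition escapes a z :=
  forall k, ((a + k%:R) / 2)%:C <= `|iter k (@fatou_map R) z|.

Lemma escapes_step a z : (a / 2)%:C <= `|z| -> escapes (a + 1) (fatou_map z) ->
  escapes a z.
Proof.
move=> h0 h [|k]; first by rewrite addr0.
by rewrite iterSr -natr1 [k%:R + 1]addrC addrA.
Qed.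

(** For [re z >= 1] one has [exp (- re z) <= 1/2], so each step moves the point right by at least
    1/2. *)
Lemma escapes_right a z : 1 <= re z -> a / 2 <= re z -> escapes a z.
Proof.
move=> z1 az k; elim: k a z z1 az => [|k ih] a z z1 az.
  by apply: norm_ge_re; rewrite ger0_norm /=; lra.
rewrite iterSr -natr1 [k%:R + 1]addrC addrA.
suff : re z + 1 / 2 <= fatou_re z by move=> h; apply: ih; rewrite re_fatou; lra.
rewrite /fatou_re; have e0 := expR_gt0 (- re z).
have e1 : expR (- re z) <= 1 / 2.
  by have := expR_ge1Dx (re z); have := expRxMexpNx_1 (re z); nra.
have := cos_geN1 (im z); nra.
Qed.

(** The sine vanishes, so the imaginary part is constant along the orbit and bounds the modulus up
    to time [a]. From time 1 on the real part is at least the time, which takes over afterwards. *)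
Lemma escapes_line a z : 0 <= a -> a <= `|im z| -> cos (im z) = 1 -> escapes a z.
Proof.
move=> a0 az cz; have sz : sin (im z) = 0 by apply: cos1sin0; rewrite cz normr1.
have step w : im w = im z ->
    im (fatou_map w) = im z /\ Num.max (re w + 1) 2 <= re (fatou_map w).
  move=> e; rewrite re_fatou im_fatou /fatou_re /fatou_im e cz sz ge_max.
  have := expR_ge1Dx (- re w); have := expR_ge0 (- re w).
  by move=> ? ?; split; [lra|apply/andP; split; lra].
have orb k : im (iter k (@fatou_map R) z) = im z /\
    (k != 0%N -> k%:R <= re (iter k (@fatou_map R) z)).
  elim: k => // k [ih1 ih2]; rewrite iterS; have [h1] := step _ ih1.
  rewrite ge_max => /andP[h2 h3]; split=> // _; case: k ih1 ih2 h1 h2 h3.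
    by move=> _ _ _ _; apply: le_trans; lra.
  by move=> k _ /(_ isT) h _ h' _; apply: le_trans h'; rewrite -natr1 lerD2r.
move=> k; have [h1 h2] := orb k.
have [ka|ka] := leP k%:R a.
  by apply: norm_ge_im; rewrite h1; lra.
have k0 : k != 0%N by apply/eqP => k0; move: ka; rewrite k0; lra.
apply: norm_ge_re; rewrite ger0_norm; first by have := h2 k0; lra.
by apply: le_trans (h2 k0); rewrite ler0n.
Qed.

(** One step throws the point far to the right, because [exp (-x) / 2] exceeds [-2 x]; then
    [escapes_right] applies. *)
Lemma escapes_fan a z : a <= - re z -> re z <= -12 -> 1 / 2 <= cos (im z) ->
  escapes a z.
Proof.
move=> az z12 cz; apply: escapes_step.
  by apply: norm_ge_re; rewrite ler0_norm; lra.
suff : - re z + 1 <= fatou_re z by move=> h; apply: escapes_right; rewrite re_fatou; lra.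
rewrite /fatou_re; have e0 := expR_gt0 (- re z).
have e4 : 4 * (- re z) + 1 <= expR (- re z) by apply: expR_ge4; lra.
nra.
Qed.

(** * One application of f between two consecutive scales *)

Section Scale.
Variables a b : R.
Hypothesis ab : scale a b.

Lemma fatou_re_gt z : - a <= re z -> - b < fatou_re z.
Proof.
move=> za; have [a12 h _] := ab; have e4 := expR_ge4 a12.
have e : expR (- re z) <= expR a by rewrite ler_expR; lra.
have e0 := expR_gt0 (- re z); have := cos_geN1 (im z); rewrite /fatou_re; nra.
Qed.

(** On this edge [|exp (-z)| = expR a <= b / 4], which leaves room for the linear terms. *)
Lemma fatou_left_edge z : re z = - a -> `|im z| <= a ->
  fatou_re z < b /\ `|fatou_im z| < b.
Proof.
have [a12 h _] := ab; have e4 := expR_ge4 a12.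
move=> za; rewrite ler_norml ltr_norml /fatou_re /fatou_im za opprK => /andP[i1 i2].
have := cos_le1 (im z); have := sin_le1 (im z); have := sin_geN1 (im z).
move=> h1 h2 h3; split; first nra.
by apply/andP; split; nra.
Qed.

Lemma re_lt_left z : fatou_re z <= - b -> re z < - a.
Proof. by rewrite !ltNge => h; apply/negP => /fatou_re_gt; rewrite ltNge h. Qed.

(** A nonnegative cosine would give [fatou_re z >= re z + 1], which is far to the right of [- b]
    because [16 a < b]. *)
Lemma cos_lt0_left z : - a - 16 <= re z -> fatou_re z <= - b -> cos (im z) < 0.
Proof.
move=> za h; rewrite ltNge; apply/negP => c0; have := scale_gt ab.
have [a12 _ _] := ab; have e0 := expR_ge0 (- re z).
by move: h; rewrite /fatou_re; have := mulr_ge0 e0 c0; lra.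
Qed.

(** Here [exp (-x)] is at least [5 b] and at least [-6 x], and one of [cos y], [sin y] has modulus
    at least 7/10. The corresponding coordinate of the image is then too large. *)
Lemma fatou_far z : re z <= - a - 16 -> `|im z| <= a ->
  b + 16 < `|fatou_re z| \/ b < `|fatou_im z|.
Proof.
have [a12 h h'] := ab; have hb := scale_gt ab.
move=> za; rewrite ler_norml /fatou_re /fatou_im => /andP[i1 i2].
set e := expR (- re z).
have e16 : 81 <= expR (16 : R).
  by apply: le_trans (@expR_ge_sqr R 16 _); lra.
have e1 : 5 * b <= e.
  have : expR a * expR 16 <= e by rewrite -expRD ler_expR; lra.
  by have := expR_gt0 a; nra.
have e2 : 6 * (- re z) <= e.
  by have := @expR_ge_sqr R (- re z); rewrite -/e; nra.
have cs := cos2Dsin2 (im z).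
have [c|c] := leP (7 / 10) `|cos (im z)|.
  left; move: c; rewrite ler_normr ltr_normr => /orP[] c; apply/orP.
    by left; nra.
  by right; nra.
have {}c : 7 / 10 <= `|sin (im z)|.
  rewrite leNgt; apply/negP; move: c; rewrite !ltr_norml.
  by move=> /andP[? ?] /andP[? ?]; nra.
right; move: c; rewrite ler_normr ltr_normr => /orP[] c; apply/orP.
  by right; nra.
by left; nra.
Qed.

(** With a cosine below 1/2, [exp (-x) cos y > b] would force [exp (-x) > 2 b] and [|sin y| > 8/10],
    making the imaginary part of the image larger than [b]. *)
Lemma cos_ge_right z : re z <= - a -> `|im z| <= a ->
  b <= fatou_re z -> `|fatou_im z| <= b -> 1 / 2 <= cos (im z).
Proof.
have [a12 h h'] := ab; have hb := scale_gt ab.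
move=> za; rewrite !ler_norml /fatou_re /fatou_im => /andP[i1 i2] f1 /andP[f2 f3].
set e := expR (- re z) in f1 f2 f3.
have e0 : 0 < e := expR_gt0 _.
rewrite leNgt; apply/negP => c.
have cs := cos2Dsin2 (im z).
have ec : b < e * cos (im z) by lra.
have e2 : 2 * b < e by nra.
have c0 : 0 < cos (im z) by rewrite -(pmulr_rgt0 _ e0); lra.
have s2 : (8 / 10) ^+ 2 < sin (im z) ^+ 2 by nra.
have : 8 / 10 < `|sin (im z)|.
  by rewrite -(@ltr_pXn2r _ 2)// ?nnegrE ?real_normK ?num_real//.
by rewrite ltr_normr => /orP[] s; nra.
Qed.

(** Moving right by [d] divides [exp (-x)] by at least [1 + d]. The delicate bound is the upper one
    on the real part when [cos y > 0]: if it failed at [w], then [exp (-x) cos y] would have dropped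
    by at least [b d] against a linear gain of [d], so it would already fail at [z]. *)
Lemma fatou_slide z w : im w = im z -> re z < re w -> `|im z| < a ->
  - b <= fatou_re z -> fatou_re z < b -> `|fatou_im z| < b -> re w <= - a ->
  [/\ - b < fatou_re w, fatou_re w < b & `|fatou_im w| < b].
Proof.
move=> ew zw iz f1 f2 f3 wa; have [a12 h h'] := ab; have hb := scale_gt ab.
have za : - a - 16 < re z.
  rewrite ltNge; apply/negP => za; case: (fatou_far za (ltW iz)).
    by rewrite ltr_normr => /orP[]; lra.
  by apply/negP; rewrite -leNgt ltW.
move: iz f1 f2 f3; rewrite /fatou_re /fatou_im ew !ltr_norml => /andP[i1 i2] f1 f2 /andP[f3 f4].
set e := expR (- re z) in f1 f2 f3 f4 *; set e' := expR (- re w).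
have e0 : 0 < e' := expR_gt0 _.
have ee : e' * (1 + (re w - re z)) <= e.
  have -> : e = e' * expR (re w - re z) by rewrite /e /e' -expRD; congr expR; ring.
  by rewrite ler_pM2l// expR_ge1Dx.
have le : e' < e by nra.
have [c|c] := leP (cos (im z)) 0.
  split; [nra|nra|].
  have [s|s] := leP 0 (sin (im z)); apply/andP; split; nra.
split; [nra| |].
  rewrite ltNge; apply/negP => f; have ec : b <= e' * cos (im z) by lra.
  have : e' * cos (im z) * (1 + (re w - re z)) <= e * cos (im z).
    by rewrite mulrAC ler_pM2r.
  by nra.
have [s|s] := leP 0 (sin (im z)); apply/andP; split; nra.
Qed.

End Scale.

(** * The half-sides of the squares *)

Section WebScale.
Variable m : nat.

(* Squares must grow like exp: fast enough to swallow the image of the previous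
   left side, slowly enough (at most 16 exp S_n) to keep the pullbacks bounded. *)
Fixpoint web_index n : nat :=
  if n is n'.+1 then (Num.truncn (expR (2 * pi * (web_index n')%:R : R))).+1
  else (m + 3)%N.

Definition web_size n : R := 2 * pi * (web_index n)%:R.

Lemma web_index_gt0 n : (0 < web_index n)%N.
Proof. by case: n => //=; rewrite addn3. Qed.

Lemma cos_web_size n : cos (web_size n) = 1.
Proof. exact: cos_nat_pi. Qed.

(** The start [m + 3] gives [web_size 0 >= 4 (m + 3) >= 12]. The constants 4 and 16 of [scale] come
    from [4 <= 2 pi <= 8] and from rounding up, which at most doubles the exponential. *)
Lemma web_size_scale n : [/\ n%:R + m%:R <= web_size n, 12 <= web_size n &
  scale (web_size n) (web_size n.+1)].
Proof.
have p2 := pi_ge2 R; have p4 : pi <= 4 :> R.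
  by have := @pihalf_lt2 R; lra.
have step k : 12 <= web_size k -> scale (web_size k) (web_size k.+1).
  move=> k12; rewrite /scale; split=> //.
    rewrite {2}/web_size /=; set e := expR _.
    have := truncnS_gt e; rewrite -/(web_size k) -/e.
    by have := expR_gt0 (web_size k); rewrite -/e; nra.
  rewrite {1}/web_size /= -/(web_size k) -natr1.
  have /andP[h _] := truncn_itv (expR_ge0 (web_size k)).
  have e1 : 1 <= expR (web_size k) by have := expR_ge4 k12; lra.
  have := ler0n R (Num.truncn (expR (web_size k))); nra.
elim: n => [|n [h1 h2 h3]].
  have h : 4 * (m + 3)%:R <= web_size 0.
    by rewrite /web_size ler_wpM2r ?ler0n//; lra.
  have m0 := ler0n R m; have h12 : 12 <= web_size 0.
    by apply: le_trans h; rewrite natrD; lra.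
  split=> //; last exact: step.
  by move: h; rewrite natrD; lra.
have h := scale_gt h3.
split; first by rewrite -natr1; lra.
  by lra.
by apply: step; lra.
Qed.

Lemma web_size_scaleS n : scale (web_size n) (web_size n.+1).
Proof. by case: (web_size_scale n). Qed.

End WebScale.
End Scales.

(** * Domains and their deformations *)

Section Strips.
Variable R : realType.
Implicit Types (x y s t a b c r : R) (z w : C R).

Definition in_strip c z := `|im z - c| <= pi / 2.

Lemma re_im_eta z : re z +i* im z = z. Proof. by case: z. Qed.

Lemma cvg_maxr (T : Type) (F : set_system T) (FF : Filter F) (g h : T -> R) a b :
  g x @[x --> F] --> a -> h x @[x --> F] --> b ->
  Num.max (g x) (h x) @[x --> F] --> Num.max a b.
Proof.
move=> ga hb; rewrite maxr_absE; under eq_fun do rewrite maxr_absE.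
apply: cvgM; last exact: cvg_cst.
by apply: cvgD; [exact: cvgD|apply: cvg_norm; exact: cvgB].
Qed.

Lemma cvg_minr (T : Type) (F : set_system T) (FF : Filter F) (g h : T -> R) a b :
  g x @[x --> F] --> a -> h x @[x --> F] --> b ->
  Num.min (g x) (h x) @[x --> F] --> Num.min a b.
Proof.
move=> ga hb; rewrite minr_absE; under eq_fun do rewrite minr_absE.
apply: cvgM; last exact: cvg_cst.
by apply: cvgB; [exact: cvgD|apply: cvg_norm; exact: cvgB].
Qed.

Lemma near_eq_cvgl (T : Type) (U : topologicalType) (F : set_system T)
    (FF : Filter F) (g h : T -> U) (l : U) :
  (\forall x \near F, g x = h x) -> h x @[x --> F] --> l -> g x @[x --> F] --> l.
Proof.
move=> gh; apply: cvg_trans; apply: near_eq_cvg.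
by near=> x; apply/esym; near: x.
Unshelve. all: by end_near. Qed.

(** Applied with [h] the image of [g] under f inside a strip: expansion of f then makes the inverse
    branch continuous. *)
Lemma cvg_dominated (T : Type) (F : set_system T) (FF : Filter F)
    (g h : T -> C R) (l k : C R) :
  (\forall x \near F, `|l - g x| <= `|k - h x|) ->
  h x @[x --> F] --> k -> g x @[x --> F] --> l.
Proof.
move=> gh /cvgrPdist_lt hk; apply/cvgrPdist_lt => e e0; near=> x.
have h1 : `|l - g x| <= `|k - h x| by near: x.
by apply: (le_lt_trans h1); near: x; exact: hk.
Unshelve. all: by end_near. Qed.

(** If [d] and [D] are the two differences, monotonicity bounds [|d|^2] by their inner product, and
    twice that product is at most [|d|^2 + |D|^2]. *)
Lemma fatou_strip_expand c z w : cos c = -1 -> in_strip c z -> in_strip c w ->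
  `|z - w| <= `|fatou_map z - fatou_map w|.
Proof.
move=> cc zc wc; have := fatou_strip_monotone cc zc wc.
rewrite !fatouE; case: z w {zc wc} => [x1 y1] [x0 y0] /= h.
rewrite !normc_def lecR ler_wsqrtr//=.
move: h; set p := fatou_re _ - _; set q := fatou_im _ - _.
by have := sqr_ge0 (x1 - x0 - p); have := sqr_ge0 (y1 - y0 - q); nra.
Qed.

Lemma fatou_strip_inj c z w : cos c = -1 -> in_strip c z -> in_strip c w ->
  fatou_map z = fatou_map w -> z = w.
Proof.
move=> cc zc wc e; have := fatou_strip_expand cc zc wc.
by rewrite e subrr normr0 normr_le0 subr_eq0 => /eqP.
Qed.

(** Here [|c - c'| <= pi] and [cos (c - c') = 1], so injectivity of the cosine on [[0, pi]]
    applies. *)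
Lemma center_unique c c' y : cos c = -1 -> cos c' = -1 ->
  `|y - c| <= pi / 2 -> `|y - c'| <= pi / 2 -> c = c'.
Proof.
move=> h h'; rewrite !ler_norml => /andP[? ?] /andP[? ?].
suff : `|c - c'| = 0 by move/normr0P; rewrite subr_eq0 => /eqP.
apply: cos_inj; rewrite ?in_itv/= ?normr_ge0 ?lexx ?pi_ge0//.
  by rewrite ler_norml; apply/andP; split; lra.
by rewrite cos_norm cosD_center// cosN h' opprK cos0.
Qed.

Lemma cos_ge0_abs s : `|s| <= pi -> 0 <= cos s -> `|s| <= pi / 2.
Proof.
move=> sp c0; rewrite leNgt; apply/negP => h.
have p0 := pi_gt0 R; move: c0; rewrite leNgt => /negP; apply.
rewrite -cos_norm -cos_pihalf ltr_cos// in_itv/=; last by rewrite normr_ge0.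
by apply/andP; split; lra.
Qed.

Lemma cos_lt0_strip c y : cos c = -1 -> `|y - c| <= pi / 2 -> cos y < 0 ->
  `|y - c| < pi / 2.
Proof.
move=> cc h cy; rewrite lt_neqAle h andbT; apply/eqP => e.
move: cy; have -> : y = c + (y - c) by ring.
by rewrite cosD_center// -cos_norm e cos_pihalf oppr0 ltxx.
Qed.

(** A classical choice with junk value 0 when [y] lies in no closed strip; [center_ofE] identifies
    it in all other cases. *)
Definition center_of y : R := xget 0 [set c | cos c = -1 /\ `|y - c| <= pi / 2].

Lemma center_ofE c y : cos c = -1 -> `|y - c| <= pi / 2 -> center_of y = c.
Proof.
move=> cc yc; have [] := @xgetPex _ 0 [set c | cos c = -1 /\ `|y - c| <= pi / 2].
  by exists c.
by rewrite -/(center_of y) => h1 h2; apply: center_unique h2 yc.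
Qed.

Definition strip_inv c w : C R := xget 0 [set z | in_strip c z /\ fatou_map z = w].

Lemma strip_invP b c w : 0 <= b -> cos c = -1 -> `|c| <= b ->
  re w <= - b -> `|im w| <= b ->
  in_strip c (strip_inv c w) /\ fatou_map (strip_inv c w) = w.
Proof.
move=> b0 cc cb wr wi; apply: (@xgetPex _ 0 [set z | in_strip c z /\ fatou_map z = w]).
by have [z] := fatou_strip_surj b0 cc cb wr wi; exists z.
Qed.

Lemma strip_invK c z : cos c = -1 -> in_strip c z ->
  strip_inv c (fatou_map z) = z.
Proof.
move=> cc zc.
have [] := @xgetPex _ 0 [set z' | in_strip c z' /\ fatou_map z' = fatou_map z].
  by exists z.
by move=> h1 h2; apply: fatou_strip_inj cc _ zc h2.
Qed.

Lemma im_strip a c z : `|c| + pi <= a -> in_strip c z -> `|im z| < a.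
Proof.
rewrite /in_strip => ca h; have -> : im z = im z - c + c by ring.
by rewrite (le_lt_trans (ler_normD _ _))//; have := pi_gt0 R; lra.
Qed.

(** * The finite stages of the domains and their deformations *)

Section Domains.
Variable m : nat.
Local Notation S := (web_size R m).
Local Notation f := (@fatou_map R).

Lemma web_size_ge12 n : 12 <= S n.
Proof. by case: (web_size_scale R m n). Qed.

Lemma web_size_gt0 n : 0 < S n.
Proof. by have := web_size_ge12 n; lra. Qed.

Lemma web_size_ltS n : S n + 16 < S n.+1.
Proof.
by have := scale_gt (web_size_scaleS R m n); have := web_size_ge12 n; lra.
Qed.

(** Since [S n] is an integer multiple of 2 pi, a whole period around the centre fits into the band.
    This margin keeps points of the strip inside the band when they are lifted. *)
Lemma web_center n y : `|y| <= S n -> cos y <= 0 ->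
  exists c, [/\ cos c = -1, `|y - c| <= pi / 2 & `|c| + pi <= S n].
Proof.
move=> yS cy; have [i [iN [c [ec yc]]]] := center_near (web_index_gt0 R m n) yS.
have p0 := pi_gt0 R.
have cc : cos c = -1 by case: ec => ->; rewrite ?cosN cos_odd_pi.
exists c; split=> //.
  apply: cos_ge0_abs => //; move: cy; have {1}-> : y = c + (y - c) by ring.
  by rewrite cosD_center// oppr_le0.
have -> : `|c| = 2 * pi * i%:R + pi.
  have h : 0 <= 2 * pi * i%:R + pi :> R by rewrite addr_ge0 ?mulr_ge0 ?ler0n//; lra.
  by case: ec => ->; rewrite ?normrN ger0_norm.
have : i.+1%:R <= (web_index R m n)%:R :> R by rewrite ler_nat.
rewrite /web_size -natr1; nra.
Qed.

(** [k] bounds the number of iterates allowed before the orbit enters a square. The domain G_n is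
    the increasing union over [k]; finite stages make induction and compactness available. *)
Fixpoint dom n k : set (C R) :=
  if k is k'.+1 then
    [set z | [/\ `|im z| < S n, re z < S n & - S n < re z \/ dom n.+1 k' (f z)]]
  else [set z | [/\ `|im z| < S n, re z < S n & - S n < re z]].

Lemma dom_im n k z : dom n k z -> `|im z| < S n.
Proof. by case: k => [|k] []. Qed.

Lemma dom_re n k z : dom n k z -> re z < S n.
Proof. by case: k => [|k] []. Qed.

Lemma domS n k : dom n k `<=` dom n k.+1.
Proof.
elim: k n => [|k ih] n z [h1 h2 h3]; split=> //; first by left.
by case: h3 => h3; [left|right; exact: ih].
Qed.

Lemma dom_le n j k : (j <= k)%N -> dom n j `<=` dom n k.
Proof.
move=> /subnK <-; elim: (k - j)%N => // i ih z /ih; exact: domS.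
Qed.

(** By induction the next stage lies in a box, and [fatou_far] shows that points further left are
    mapped out of that box. *)
Lemma dom_far n k z : dom n k z -> - S n - 16 < re z.
Proof.
elim: k n z => [|k ih] n z [h1 h2]; first by lra.
move=> [h3|h3]; first by lra.
rewrite ltNge; apply/negP => zS.
have := fatou_far (web_size_scaleS R m n) zS (ltW h1).
have := ih _ _ h3; have := dom_im h3; have := dom_re h3.
rewrite re_fatou im_fatou => r1 r2 r3 [|]; last by rewrite ltNge ltW.
by rewrite ltr_normr => /orP[]; lra.
Qed.

Lemma near_lt (T : Type) (F : set_system T) (FF : Filter F) (g : T -> R) l r :
  g x @[x --> F] --> l -> l < r -> \forall x \near F, g x < r.
Proof. by move=> gl lr; apply: (cvgr_lt l). Qed.

Lemma near_gt (T : Type) (F : set_system T) (FF : Filter F) (g : T -> R) l r :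
  g x @[x --> F] --> l -> r < l -> \forall x \near F, r < g x.
Proof. by move=> gl lr; apply: (cvgr_gt l). Qed.

Lemma near_dom n k (T : Type) (F : set_system T) (FF : Filter F) (g : T -> C R) z :
  g x @[x --> F] --> z -> dom n k z -> \forall x \near F, dom n k (g x).
Proof.
elim: k n g z => [|k ih] n g z gz [h1 h2 h3].
  near=> x; split; near: x.
  - by apply: near_lt h1; apply: cvg_norm; exact: cvg_im.
  - by apply: near_lt h2; exact: cvg_re.
  - by apply: near_gt h3; exact: cvg_re.
have i1 : \forall x \near F, `|im (g x)| < S n.
  by apply: near_lt h1; apply: cvg_norm; exact: cvg_im.
have i2 : \forall x \near F, re (g x) < S n.
  by apply: near_lt h2; exact: cvg_re.
case: h3 => h3.
  have i3 : \forall x \near F, - S n < re (g x).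
    by apply: near_gt h3; exact: cvg_re.
  by near=> x; split; [near: x|near: x|left; near: x].
have i3 : \forall x \near F, dom n.+1 k (f (g x)).
  by apply: ih h3; exact: cvg_fatou.
by near=> x; split; [near: x|near: x|right; near: x].
Unshelve. all: by end_near. Qed.

Lemma dom_open n k : open (dom n k).
Proof.
by rewrite openE => z zk; apply: (@near_dom n k _ (nbhs z) _ id z) => //; exact: cvg_id.
Qed.

Lemma dom_left_edge n k z : `|im z| < S n -> re z < S n -> - S n <= re z ->
  dom n k.+1 z.
Proof.
move=> h1 h2; rewrite le_eqVlt => /orP[/eqP h3|h3]; split=> //; last by left.
right; apply: (@dom_le _ 0) => //.
have sc := web_size_scaleS R m n.
have [e1 e2] := fatou_left_edge sc (esym h3) (ltW h1).
split; rewrite ?re_fatou ?im_fatou//; apply: (fatou_re_gt sc); lra.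
Qed.

(* The parameter t runs over all reals, with the identity for t <= 0, so that
   no continuity statement needs a restriction to a subspace. *)
Definition deformation n k (h : R -> C R -> C R) :=
  [/\ forall t z, dom n k z -> dom n k (h t z),
      forall (T : Type) (F : set_system T) (u : T -> R) (v : T -> C R) t z,
        Filter F -> dom n k z -> u x @[x --> F] --> t -> v x @[x --> F] --> z ->
        h (u x) (v x) @[x --> F] --> h t z,
      forall t z, t <= 0 -> dom n k z -> h t z = z,
      forall t z, 1 <= t -> dom n k z -> - S n <= re (h t z) &
      forall t z, (- S n <= re z -> h t z = z) /\
        (dom n k z -> re z <= - S n -> re (h t z) <= - S n)].

(** At [s = 1] this is the horizontal projection onto the half-plane to the right of the left
    edge. *)
Definition slide n s z : C R := (re z + s * Num.max (- S n - re z) 0) +i* im z.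

Definition clamp t : R := Num.max 0 (Num.min t 1).

Lemma clamp_ge0 t : 0 <= clamp t.
Proof. by rewrite /clamp le_max lexx. Qed.

Lemma clamp_le1 t : clamp t <= 1.
Proof. by rewrite /clamp ge_max ler01 ge_min lexx orbT. Qed.

Lemma clamp_le0 t : t <= 0 -> clamp t = 0.
Proof.
by move=> t0; apply/eqP; rewrite eq_le clamp_ge0 andbT ge_max lexx ge_min t0.
Qed.

Lemma clamp_ge1 t : 1 <= t -> clamp t = 1.
Proof.
by move=> t1; apply/eqP; rewrite eq_le clamp_le1 le_max le_min t1 lexx orbT.
Qed.

Lemma clamp_id t : 0 <= t -> t <= 1 -> clamp t = t.
Proof. by move=> t0 t1; rewrite /clamp (min_idPl t1) (max_idPr t0). Qed.

Lemma cvg_clamp (T : Type) (F : set_system T) (FF : Filter F) (u : T -> R) t :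
  u x @[x --> F] --> t -> clamp (u x) @[x --> F] --> clamp t.
Proof.
move=> ut; apply: cvg_maxr; first exact: cvg_cst.
by apply: cvg_minr => //; exact: cvg_cst.
Qed.

Lemma slide_id n s z : - S n <= re z -> slide n s z = z.
Proof.
move=> h; rewrite /slide (max_idPr _) ?mulr0 ?addr0; first by case: z h.
by lra.
Qed.

Lemma slide0 n z : slide n 0 z = z.
Proof. by rewrite /slide mul0r addr0; case: z. Qed.

Lemma slideE n s z : re z <= - S n ->
  slide n s z = ((1 - s) * re z - s * S n) +i* im z.
Proof.
move=> h; rewrite /slide (max_idPl _); last by lra.
by congr (_ +i* _); ring.
Qed.

Lemma cvg_slide n (T : Type) (F : set_system T) (FF : Filter F) (u : T -> R)
    (v : T -> C R) t z :
  u x @[x --> F] --> t -> v x @[x --> F] --> z ->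
  slide n (u x) (v x) @[x --> F] --> slide n t z.
Proof.
move=> ut vz; apply: cvgC => /=; last exact: cvg_im.
apply: cvgD; first exact: cvg_re.
apply: cvgM => //; apply: cvg_maxr; last exact: cvg_cst.
by apply: cvgB; [exact: cvg_cst|exact: cvg_re].
Qed.

(** * Lifting a deformation from one level to the preceding one *)

Section Lift.
Variables (n k : nat) (h : R -> C R -> C R).
Hypothesis hd : deformation n.+1 k h.

(* Continuity of the lift needs no pasting: the strip inverse is 1-Lipschitz. *)
Definition lift t z : C R :=
  if (- S n <= re z) || (- S n.+1 <= fatou_re z) then z
  else strip_inv (center_of (im z)) (h t (f z)).

Lemma lift_right t z : - S n <= re z -> lift t z = z.
Proof. by rewrite /lift => ->. Qed.

Lemma dom_tail z : dom n k.+1 z -> re z <= - S n -> dom n.+1 k (f z).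
Proof. by move=> [_ _ []//]; rewrite ltNge => /negP. Qed.

(** The last inequality is strict so that nearby points lie in the same strip and use the same
    inverse branch. *)
Lemma dom_strip z : dom n k.+1 z -> fatou_re z <= - S n.+1 ->
  exists c, [/\ cos c = -1, `|c| + pi <= S n & `|im z - c| < pi / 2].
Proof.
move=> zd fz; have cz : cos (im z) < 0.
  by apply: (cos_lt0_left (web_size_scaleS R m n)) fz; exact/ltW/dom_far/zd.
have [c [h1 h2 h3]] := web_center (ltW (dom_im zd)) (ltW cz).
by exists c; split=> //; exact: cos_lt0_strip.
Qed.

(** Where [lift] is the identity, [h] fixes [f z] as well. So in the strip of [c] both formulas of
    [lift] give the inverse branch applied to [h t (f z)]. *)
Lemma lift_strip c t z : dom n k.+1 z -> cos c = -1 -> `|c| + pi <= S n ->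
  in_strip c z -> re z <= - S n ->
  in_strip c (lift t z) /\ f (lift t z) = h t (f z).
Proof.
have [hdom _ _ _ hfix] := hd.
move=> zd cc cS zc zS; have fzd := dom_tail zd zS; rewrite /lift.
case: ifPn => [/orP[h1|h1]|].
- suff -> : h t (f z) = f z by [].
  apply: (hfix t (f z)).1; rewrite re_fatou ltW//.
  exact: (fatou_re_gt (web_size_scaleS R m n)).
- by split=> //; rewrite (hfix t (f z)).1// re_fatou.
rewrite negb_or -!ltNge => /andP[h1 h2].
rewrite (center_ofE cc zc); apply: (strip_invP (ltW (web_size_gt0 n.+1))) => //.
- by have := web_size_ltS n; have := pi_gt0 R; lra.
- by apply: (hfix _ _).2 => //; rewrite re_fatou ltW.
- exact/ltW/dom_im/(hdom t _ fzd).
Qed.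

Lemma lift_cases t z : dom n k.+1 z -> re z <= - S n ->
  lift t z = z /\ - S n.+1 <= fatou_re z \/
  exists c, [/\ cos c = -1, `|c| + pi <= S n, in_strip c z & fatou_re z <= - S n.+1].
Proof.
move=> zd zS; have [fz|fz] := leP (- S n.+1) (fatou_re z).
  by left; rewrite /lift fz orbT.
right; have [c [h1 h2 h3]] := dom_strip zd (ltW fz).
by exists c; split=> //; exact: ltW.
Qed.

Lemma lift_fatou t z : dom n k.+1 z -> re z <= - S n ->
  f (lift t z) = h t (f z).
Proof.
move=> zd zS; case: (lift_cases t zd zS) => [[-> fz]|[c [h1 h2 h3 h4]]].
  by case: hd => _ _ _ _ /(_ t (f z)) [-> //]; rewrite re_fatou.
by case: (@lift_strip c t z).
Qed.

Lemma lift_im t z : dom n k.+1 z -> re z <= - S n -> `|im (lift t z)| < S n.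
Proof.
move=> zd zS; case: (lift_cases t zd zS) => [[-> _]|[c [h1 h2 h3 h4]]].
  exact: dom_im zd.
by apply: (im_strip h2); case: (@lift_strip c t z).
Qed.

Lemma lift_re t z : dom n k.+1 z -> re z <= - S n -> re (lift t z) <= - S n.
Proof.
move=> zd zS; case: (lift_cases t zd zS) => [[-> _]//|[c [h1 h2 h3 h4]]].
apply: ltW; apply: (re_lt_left (web_size_scaleS R m n)).
rewrite -re_fatou lift_fatou//; case: hd => _ _ _ _ /(_ t (f z)) [_]; apply.
  exact: dom_tail.
by rewrite re_fatou.
Qed.

Lemma lift_le0 t z : t <= 0 -> dom n k.+1 z -> lift t z = z.
Proof.
move=> t0 zd; have [zS|zS] := leP (- S n) (re z); first by rewrite /lift zS.
case: (lift_cases t zd (ltW zS)) => [[-> _]//|[c [h1 h2 h3 h4]]].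
have [l1 l2] := lift_strip t zd h1 h2 h3 (ltW zS).
apply: (fatou_strip_inj h1 l1 h3); rewrite l2.
by case: hd => _ _ + _ _; apply=> //; exact: dom_tail (ltW zS).
Qed.

Lemma cvg_lift (T : Type) (F : set_system T) (FF : Filter F) (u : T -> R)
    (v : T -> C R) t z : dom n k.+1 z ->
  u x @[x --> F] --> t -> v x @[x --> F] --> z ->
  lift (u x) (v x) @[x --> F] --> lift t z.
Proof.
move=> zd ut vz; have [zS|zS] := ltP (- S n) (re z).
  rewrite {2}/lift (ltW zS) /=.
  have nS : \forall x \near F, - S n < re (v x).
    by apply: near_gt zS; exact: cvg_re.
  apply: (@near_eq_cvgl _ _ F FF _ v _ _ vz); near=> x.
  have h1 : - S n < re (v x) by near: x.
  by rewrite /lift (ltW h1).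
have [fz|fz] := ltP (- S n.+1) (fatou_re z).
  rewrite {2}/lift (ltW fz) orbT.
  have nS : \forall x \near F, - S n.+1 < fatou_re (v x).
    by apply: near_gt fz; exact: cvg_fatou_re.
  apply: (@near_eq_cvgl _ _ F FF _ v _ _ vz); near=> x.
  have h1 : - S n.+1 < fatou_re (v x) by near: x.
  by rewrite /lift (ltW h1) orbT.
(* This case contains the borderline where [lift] changes formula; [lift_strip] treats both formulas
   at once. *)
have {}zS := re_lt_left (web_size_scaleS R m n) fz.
have [c [h1 h2 h3]] := dom_strip zd fz.
apply: (@cvg_dominated T F FF (fun p => lift (u p) (v p))
  (fun p => h (u p) (f (v p))) (lift t z) (h t (f z))).
  have n1 : \forall x \near F, dom n k.+1 (v x) by apply: near_dom zd.
  have n2 : \forall x \near F, re (v x) < - S n.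
    by apply: near_lt zS; exact: cvg_re.
  have n3 : \forall x \near F, `|im (v x) - c| < pi / 2.
    apply: near_lt h3; apply: cvg_norm; apply: cvgB; last exact: cvg_cst.
    exact: cvg_im.
  near=> x.
  have i1 : dom n k.+1 (v x) by near: x.
  have i2 : re (v x) < - S n by near: x.
  have i3 : `|im (v x) - c| < pi / 2 by near: x.
  have [l1 l2] := lift_strip t zd h1 h2 (ltW h3) (ltW zS).
  have [l3 l4] := lift_strip (u x) i1 h1 h2 (ltW i3) (ltW i2).
  by rewrite -l2 -l4; exact: (fatou_strip_expand h1).
have [_ hc _ _ _] := hd.
exact: (hc T F u (fun p => f (v p)) t (f z) FF (dom_tail zd (ltW zS)) ut
  (cvg_fatou FF vz)).
Unshelve. all: by end_near. Qed.

(** Up to time 1/2 only the lift acts. By then f maps the point to the right of the left edge of the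
    next square, so that sliding stays inside the domain by [fatou_slide]. *)
Definition lift_slide t z : C R := slide n (clamp (2 * t - 1)) (lift (2 * t) z).

Lemma lift_slide_dom t z : dom n k.+1 z -> dom n k.+1 (lift_slide t z).
Proof.
move=> zd; rewrite /lift_slide; have [zS|zS] := leP (- S n) (re z).
  by rewrite lift_right// slide_id.
have {}zS := ltW zS.
have [hdom _ _ hend _] := hd; have fzd := dom_tail zd zS.
have lr := lift_re (2 * t) zd zS; have li := lift_im (2 * t) zd zS.
have lf := lift_fatou (2 * t) zd zS.
have ld : dom n.+1 k (f (lift (2 * t) z)) by rewrite lf; exact: hdom.
have S0 := web_size_gt0 n.
have [t1|t1] := leP t (1 / 2).
  rewrite clamp_le0 ?slide0; last by lra.
  by split=> //; [lra|right].
set s := clamp _; set l := lift _ _ in lr li lf ld *.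
have s0 : 0 <= s := clamp_ge0 _; have s1 : s <= 1 := clamp_le1 _.
rewrite slideE//.
(* [fatou_slide] requires a strict displacement, so the motionless case is split off. A point that
   moves has its image in the next square itself, which is stage 0. *)
have [e|e] := eqVneq (- (s * S n) + (1 - s) * re l) (re l).
  rewrite addrC e; rewrite re_im_eta.
  by split=> //; [lra|right].
have lt : re l < (1 - s) * re l - s * S n.
  by rewrite lt_neqAle eq_sym addrC e /=; nra.
split=> //=; [nra|right; apply: (@dom_le _ 0) => //].
have hr : - S n.+1 <= fatou_re l.
  by rewrite -re_fatou lf; apply: hend => //; lra.
have [] := @fatou_slide _ _ _ (web_size_scaleS R m n) l
  (((1 - s) * re l - s * S n) +i* im l).
- by [].
- by [].
- by [].
- by [].
- by rewrite -re_fatou; exact: dom_re ld.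
- by rewrite -im_fatou; exact: dom_im ld.
- by move=> /=; nra.
by move=> q1 q2 q3; split; rewrite ?re_fatou ?im_fatou.
Qed.

Lemma deformation_lift_slide : deformation n k.+1 lift_slide.
Proof.
split.
- exact: lift_slide_dom.
- move=> T F u v t z FF zd ut vz; apply: cvg_slide.
    by apply: cvg_clamp; apply: cvgB; [apply: cvgM => //; exact: cvg_cst|exact: cvg_cst].
  by apply: cvg_lift => //; apply: cvgM => //; exact: cvg_cst.
- move=> t z t0 zd; rewrite /lift_slide clamp_le0 ?slide0; last by lra.
  by rewrite lift_le0//; lra.
- move=> t z t1 zd; rewrite /lift_slide clamp_ge1; last by lra.
  have [zS|zS] := leP (- S n) (re z); first by rewrite lift_right// slide_id.
  by rewrite slideE /=; [lra|apply: lift_re (ltW zS)].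
- move=> t z; split=> [zS|zd zS].
    by rewrite /lift_slide lift_right// slide_id.
  have lr := lift_re (2 * t) zd zS.
  rewrite /lift_slide slideE//=.
  by have := clamp_ge0 (2 * t - 1); have := clamp_le1 (2 * t - 1); nra.
Qed.

End Lift.

Lemma deformation_exists n k : exists h, deformation n k h.
Proof.
elim: k n => [|k ih] n.
  by exists (fun _ z => z); split=> // t z _ [_ _ /ltW].
by have [h /deformation_lift_slide hd] := ih n.+1; eexists; exact: hd.
Qed.

End Domains.
End Strips.

(** * Topological preliminaries *)

Section GeneralTopology.
Variable T : ptopologicalType.

Lemma compact_sub_increasing (A : set T) (O : nat -> set T) : compact A ->
  (forall k, open (O k)) -> (forall j k, (j <= k)%N -> O j `<=` O k) ->
  A `<=` \bigcup_k O k -> exists k, A `<=` O k.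
Proof.
rewrite compact_cover => Ac oO mO AO.
have [D _ AD] := Ac nat setT O (fun k _ => oO k) AO.
exists (\max_(i <- finmap.enum_fset D) i)%N => z /AD[i /= iD].
by apply: mO; exact: (@leq_bigmax_seq _ _ xpredT id).
Qed.

(** A separation of the intersection consists of two closed sets. Normality inside [K] gives them
    separated open neighbourhoods [U] and [W], and compactness puts some [A k] inside their union,
    against its connectedness. *)
Lemma connected_bigcap (K : set T) (A : nat -> set T) :
  hausdorff_space T -> compact K -> (forall k, A k `<=` K°) ->
  (forall k, closed (A k)) -> (forall j k, (j <= k)%N -> A k `<=` A j) ->
  (forall k, connected (A k)) -> connected (\bigcap_k A k).
Proof.
move=> hT cK AK cA mA kA; apply/connectedP => E [E0 EU [s1 s2]].
have EA b k : E b `<=` A k.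
  have h : \bigcap_k A k `<=` A k by move=> z; apply.
  by apply: subset_trans h; rewrite EU; case: b; [exact: subsetUr|exact: subsetUl].
have cE : closed (E false).
  move=> z zE; have : (\bigcap_k A k) z.
    apply: (@closed_bigI _ _ setT A (fun k _ => cA k)); apply: closureS zE.
    by rewrite EU; exact: subsetUl.
  by rewrite EU => -[//|zt]; have : (closure (E false) `&` E true) z by []; rewrite s1.
have cE' : closed (E true).
  move=> z zE; have : (\bigcap_k A k) z.
    apply: (@closed_bigI _ _ setT A (fun k _ => cA k)); apply: closureS zE.
    by rewrite EU; exact: subsetUr.
  by rewrite EU => -[zt|//]; have : (E false `&` closure (E true)) z by []; rewrite s2.
have nE : set_nbhs (E false) (~` E true).
  apply/set_nbhsP; exists (~` E true); split=> //; first exact: closed_openC.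
  move=> z zf zt; have : (closure (E false) `&` E true) z.
    by split=> //; exact: subset_closure.
  by rewrite s1.
have [V /set_nbhsP[U [oU EfU UV]] VE] :=
  compact_normal_local hT cK (subset_trans (EA false 0%N) (AK 0%N)) cE nE.
pose W := ~` closure V.
have oW : open W by apply: closed_openC; exact: closed_closure.
have EtW : E true `<=` W by move=> z zt /VE.
have sepUW : separated U W.
  split; apply/seteqP; split=> // z [].
    by move=> zU; apply; apply: (closureS UV).
  move=> zU; have : closure W `<=` ~` U.
    apply: (@subset_trans _ (closure (~` U))).
      by apply: closureS => w wW wU; apply: wW; apply: subset_closure; exact: UV.
    by have /closure_id <- := open_closedC oU.
  by move=> /[apply].
have [k Ak] : exists k, A 0%N `<=` (~` A k `|` (U `|` W)).
  apply: compact_sub_increasing.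
  - apply: (subclosed_compact (cA 0%N) cK).
    by apply: subset_trans (AK 0%N) _; exact: interior_subset.
  - by move=> k; apply: openU; [exact: closed_openC|exact: openU].
  - by move=> i j ij z [h|h]; [left => /(mA _ _ ij)|right].
  - move=> z _; have [zA|/existsNP[k zk]] := pselect (forall k, A k z).
      have : (\bigcap_k A k) z by move=> k _; exact: zA.
      by rewrite EU => -[/EfU|/EtW] h; exists 0%N => //; right; [left|right].
    by exists k => //; left.
have {}Ak : A k `<=` U `|` W by move=> z zk; case: (Ak z (mA _ _ (leq0n k) _ zk)).
have [z1 h1] := E0 true; have [z0 h0] := E0 false.
have := separated_disjoint sepUW.
have [h|h] := connected_subset sepUW Ak (kA k).
  by move/seteqP => [+ _] => /(_ z1); apply; split; [apply: h; exact: EA h1|exact: EtW].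
by move/seteqP => [+ _] => /(_ z0); apply; split; [exact: EfU|apply: h; exact: EA h0].
Qed.

Lemma connected_from (A : set T) p : A p ->
  (forall z, A z -> connected_component A p z) -> connected A.
Proof.
move=> Ap h; suff -> : A = connected_component A p by exact: component_connected.
by apply/seteqP; split; [exact: h|exact: connected_component_sub].
Qed.

Lemma connected_component_path (R : realType) (A : set T) (g : R -> T) (a b : R) :
  a <= b -> (forall t, a <= t <= b -> A (g t) /\ g x @[x --> t] --> g t) ->
  connected_component A (g a) (g b).
Proof.
move=> ab h; exists (g @` `[a, b]); last first.
  by exists b; rewrite /= ?in_itv/= ?ab ?lexx.
split.
- by exists a; rewrite /= ?in_itv/= ?ab ?lexx.
- by move=> _ [t /= tab <-]; apply: (h t _).1; move: tab; rewrite in_itv.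
- apply: connected_continuous_connected; first exact: segment_connected.
  apply: continuous_in_subspaceT => t; rewrite inE/= in_itv/= => tab.
  exact: (h t tab).2.
Qed.

End GeneralTopology.

(** * Simple connectedness *)

Section WebDomain.
Variables (R : realType) (m : nat).
Implicit Types (x y s t a b c r : R) (z w : C R).
Local Notation S := (web_size R m).
Local Notation f := (@fatou_map R).

Definition web_dom n : set (C R) := \bigcup_k dom m n k.

Definition dilate r z : C R := (r * re z) +i* (r * im z).

Lemma cvg_dilate (T : Type) (F : set_system T) (FF : Filter F) (u : T -> R)
    (v : T -> C R) r z :
  u p @[p --> F] --> r -> v p @[p --> F] --> z ->
  dilate (u p) (v p) @[p --> F] --> dilate r z.
Proof.
by move=> ur vz; apply: cvgC => /=; apply: cvgM => //; [exact: cvg_re|exact: cvg_im].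
Qed.

(** The deformation pushes the stage into a square, which is star-shaped about 0; a dilation then
    shrinks it to 0. *)
Lemma contraction_exists n k : exists h : R -> C R -> C R,
  [/\ forall t z, dom m n k z -> web_dom n (h t z),
      forall (T : Type) (F : set_system T) (u : T -> R) (v : T -> C R) t z,
        Filter F -> dom m n k z -> u p @[p --> F] --> t -> v p @[p --> F] --> z ->
        h (u p) (v p) @[p --> F] --> h t z,
      forall z, dom m n k z -> h 0 z = z &
      forall z, h 1 z = 0].
Proof.
have [h [hdom hc h0 h1 _]] := deformation_exists R m n k.
exists (fun t z => dilate (1 - clamp (2 * t - 1)) (h (2 * t) z)); split.
- move=> t z zd; have [t1|t1] := leP t (1 / 2).
    exists k => //; rewrite clamp_le0; last by lra.
    rewrite subr0 /dilate !mul1r re_im_eta; exact: hdom.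
  (* After time 1/2 the point may lie on the left edge, which belongs to stage 1 but not to stage 0.
     Hence the target is [web_dom n] and not [dom m n k]. *)
  exists 1%N => //; have := hdom (2 * t) z zd.
  set w := h _ _ => wd.
  have wS : - S n <= re w by apply: h1 => //; lra.
  have := dom_im wd; have := dom_re wd; rewrite ltr_norml => wr /andP[wi wi'].
  have := web_size_gt0 R m n.
  set r := 1 - clamp _; have r0 : 0 <= r by rewrite subr_ge0 clamp_le1.
  have r1 : r <= 1 by rewrite lerBlDr lerDl clamp_ge0.
  move=> S0; apply: dom_left_edge => /=; rewrite ?ltr_norml; last nra.
    by apply/andP; split; nra.
  by nra.
- move=> T F u v t z FF zd ut vz; apply: cvg_dilate.
    apply: cvgB; first exact: cvg_cst.
    by apply: cvg_clamp; apply: cvgB; [apply: cvgM => //; exact: cvg_cst|exact: cvg_cst].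
  have u2 : 2 * u p @[p --> F] --> 2 * t by apply: cvgM => //; exact: cvg_cst.
  exact: (hc T F (fun p => 2 * u p) v (2 * t) z FF zd u2 vz).
- move=> z zd; rewrite clamp_le0; last by lra.
  by rewrite mulr0 h0// subr0 /dilate !mul1r re_im_eta.
- move=> z; rewrite clamp_ge1; last by lra.
  by rewrite subrr /dilate !mul0r.
Qed.

Lemma web_dom0 n : web_dom n 0.
Proof.
have := web_size_gt0 R m n.
by exists 0%N => //=; split; rewrite ?normr0//; lra.
Qed.

Lemma web_dom_open n : open (web_dom n).
Proof. by apply: bigcup_open => k _; exact: dom_open. Qed.

(** Each point is joined to 0 by its own track under a contraction. *)
Lemma web_dom_connected n : connected (web_dom n).
Proof.
rewrite (_ : web_dom n = \bigcup_(A in [set A : set (C R) |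
    [/\ A 0, A `<=` web_dom n & connected A]]) A); last first.
  apply/seteqP; split=> [z [k _ zk]|z [A [_ AG _]]]; last exact: AG.
  have [h [hd hc h0 h1]] := contraction_exists n k.
  exists ((fun t => h t z) @` `[0, 1]); last first.
    by exists 0; [rewrite /= in_itv/= lexx ler01|exact: h0].
  split.
  - by exists 1; [rewrite /= in_itv/= lexx ler01|exact: h1].
  - by move=> _ [t _ <-]; exact: hd.
  - apply: connected_continuous_connected; first exact: segment_connected.
    apply: continuous_subspaceT => t.
    apply: (hc R (nbhs t) id (fun=> z) t z _ zk); first exact: cvg_id.
    exact: cvg_cst.
by apply: bigcup_connected => [|A [_ _]//]; exists 0 => A [].
Qed.

Lemma continuous_clamp_comp (g : R -> C R) :
  {within `[0, 1], continuous g} -> continuous (g \o @clamp R).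
Proof.
move=> /subspace_continuousP gc t.
have c01 : `[0, 1]%classic (clamp t) by rewrite /= in_itv/= clamp_ge0 clamp_le1.
apply: (@cvg_comp _ _ _ (@clamp R) g (nbhs t) (within `[0, 1]%classic (nbhs (clamp t)))).
  move=> A; rewrite /within /= => An.
  have cc : clamp p @[p --> t] --> clamp t by apply: (@cvg_clamp R R (nbhs t) _ id t); exact: cvg_id.
  apply: (@filterS _ (nbhs t) _ _ _ _ (cc _ An)) => p; apply.
  by rewrite /= in_itv/= clamp_ge0 clamp_le1.
exact: gc.
Qed.

(** A loop is compact, hence contained in a single stage, and the contraction of that stage supplies
    the homotopy. *)
Lemma web_dom_simply_connected n : simply_connected_domain R (web_dom n).
Proof.
split.
- by exists 0; exact: web_dom0.
- exact: web_dom_open.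
- exact: web_dom_connected.
move=> g [gc gG g01].
have gc' := continuous_clamp_comp gc.
have gG' t : web_dom n (g (clamp t)).
  by apply: gG; exists (clamp t) => //=; rewrite in_itv/= clamp_ge0 clamp_le1.
have [k gk] : exists k, (g \o @clamp R) @` `[0, 1] `<=` dom m n k.
  apply: compact_sub_increasing; last by move=> _ [t _ <-]; exact: gG'.
  - apply: continuous_compact; last exact: segment_compact.
    exact: continuous_subspaceT.
  - by move=> j; exact: dom_open.
  - by move=> i j; exact: dom_le.
have {}gk t : dom m n k (g (clamp t)).
  apply: gk; exists (clamp t); first by rewrite /= in_itv/= clamp_ge0 clamp_le1.
  by rewrite /= clamp_id// ?clamp_ge0 ?clamp_le1.
have [h [hd hc h0 h1]] := contraction_exists n k.
exists (fun p => h p.1 (g (clamp p.2))); split.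
- apply: continuous_subspaceT => -[s t].
  apply: (hc (R * R)%type (nbhs (s, t)) fst (fun p => g (clamp p.2)) s (g (clamp t)) _ (gk t)).
    exact: cvg_fst.
  apply: (@cvg_comp _ _ _ snd (g \o @clamp R) _ (nbhs t)); first exact: cvg_snd.
  exact: gc'.
- by move=> _ [p _ <-]; exact: hd.
- move=> t; rewrite in_itv/= => /andP[t0 t1].
  by rewrite h0// clamp_id.
- by move=> s _; rewrite /= clamp_le0// clamp_ge1// g01.
- by exists 0 => t _ /=; exact: h1.
Qed.

Lemma web_dom_bounded n : bounded_set (web_dom n).
Proof.
exists (2 * S n + 16)%:C; split; first by apply/complex_realP; eexists.
move=> M SM z [k _ zk]; apply/ltW/(le_lt_trans _ SM).
have := dom_im zk; have := dom_re zk; have := dom_far zk.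
rewrite ltr_norml => h1 h2 /andP[h3 h4]; have S0 := web_size_gt0 R m n.
rewrite normc_def lecR -[leRHS]ger0_norm -?sqrtr_sqr; last by lra.
by apply: ler_wsqrtr; nra.
Qed.

Lemma web_domS n : web_dom n `<=` web_dom n.+1.
Proof.
move=> z [k _ zk]; exists 0%N => //.
have := dom_im zk; have := dom_re zk; have := dom_far zk.
have := web_size_ltS R m n => h0 h1 h2 h3.
by split; lra.
Qed.

Lemma bigcup_web_dom : \bigcup_n web_dom n = setT.
Proof.
apply/seteqP; split=> // z _.
have [n nz] : exists n, `|re z| + `|im z| < n%:R.
  exists (Num.truncn (`|re z| + `|im z|)).+1; exact: truncnS_gt.
have [h _ _] := web_size_scale R m n.
have := ler0n R m; have := ler_norm (re z); have := ler_norm (- re z).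
have := normr_ge0 (im z); have := normr_ge0 (re z); rewrite normrN.
move=> h1 h2 h3 h4 h5.
by exists n => //; exists 0%N => //; split; lra.
Qed.

End WebDomain.

(** * Arcs of the web *)

Section WebArcs.
Variables (R : realType) (m : nat).
Implicit Types (x y s t a b c e r : R) (z w : C R).
Local Notation S := (web_size R m).
Local Notation f := (@fatou_map R).

Lemma cos_anti s t : 0 <= s -> s <= t -> t <= pi -> cos t <= cos s.
Proof.
by move=> s0 st tp; rewrite leNgt ltr_cos ?in_itv/= -?leNgt ?s0 ?tp ?(le_trans s0 st) ?(le_trans st tp).
Qed.

Lemma cos_acosN2 : cos (acos (- (1 / 2))) = - (1 / 2) :> R.
Proof. by rewrite acosK// in_itv/=; apply/andP; split; lra. Qed.

Lemma acosN2_ltpi : acos (- (1 / 2)) < pi :> R.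
Proof. by apply: acos_ltpi; lra. Qed.

Lemma acosN2_ge0 : 0 <= acos (- (1 / 2)) :> R.
Proof. by apply: acos_ge0; apply/andP; split; lra. Qed.

(** [acos (- (1 / 2))] is 2 pi / 3. If the sine has fallen below [sin s], the cosine at [t] is
    negative but at least -1/2, which keeps the sine above 1/2. *)
Lemma sin_acosN2 s t : 0 < s -> s <= t -> t <= acos (- (1 / 2)) ->
  sin s <= sin t \/ 1 / 2 <= sin t.
Proof.
move=> s0 st tp; have tpi := le_lt_trans tp acosN2_ltpi.
have t0 : 0 < t by rewrite (lt_le_trans s0).
have ct1 : cos t <= cos s by apply: cos_anti => //; exact: ltW.
have ct2 : - (1 / 2) <= cos t.
  by rewrite -cos_acosN2; apply: cos_anti => //; apply: ltW => //; exact: acosN2_ltpi.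
have ss : 0 < sin s by apply: sin_gt0_pi; rewrite s0 (le_lt_trans st).
have st0 : 0 < sin t by apply: sin_gt0_pi; rewrite t0.
have h1 := cos2Dsin2 s; have h2 := cos2Dsin2 t.
move: (cos s) (sin s) (cos t) (sin t) ct1 ct2 ss st0 h1 h2 => cs sn ct sn'.
move=> ct1 ct2 ss st0 h1 h2.
have [h|h] := leP sn sn'; [by left|right].
have ct0 : ct < 0 by rewrite ltNge; apply/negP => ct0; nra.
by nra.
Qed.

(** The quotient is [exp (-x)] along a level curve, and the bounds keep the curve in its box. If
    [sin t >= sin s] the upper bound is inherited from the starting point; otherwise [sin t >= 1/2]
    and [b <= 16 expR a] suffices. *)
Lemma curve_quotient a b d s t x : scale a b -> - a <= d -> d <= a ->
  0 < s -> s <= t -> t <= acos (- (1 / 2)) ->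
  expR (- x) * sin s = b - s - d -> - x <= a + 16 ->
  expR a <= (b - t - d) / sin t <= expR (a + 16).
Proof.
move=> sc d1 d2 s0 st tp e xa; have [a12 sc1 sc2] := sc.
have tpi := le_lt_trans tp acosN2_ltpi; have p4 := @pihalf_lt2 R.
have t0 : 0 < t by rewrite (lt_le_trans s0).
have st0 : 0 < sin t by apply: sin_gt0_pi; rewrite t0.
have ss : 0 < sin s by apply: sin_gt0_pi; rewrite s0 (le_lt_trans st).
have e4 := expR_ge4 a12; have ea := expR_gt0 a.
rewrite ler_pdivrMr// ler_pdivlMr// expRD; apply/andP; split.
  have : expR a * sin t <= expR a by rewrite ler_piMr ?sin_le1// ltW.
  by move: e4 sc1 tpi p4; lra.
have e16 : 81 <= expR (16 : R).
  have h : 0 <= (16 : R) by [].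
  by apply: le_trans (expR_ge_sqr h); clear; lra.
have [st'|st2] := sin_acosN2 s0 st tp.
  have uz : expR (- x) <= expR a * expR 16 by rewrite -expRD ler_expR.
  have : expR (- x) * sin s <= expR a * expR 16 * sin t.
    by apply: ler_pM => //; rewrite ?expR_ge0 ?ltW.
  by rewrite e; apply: le_trans; rewrite lerD2r lerD2l lerN2.
have h81 : expR a * 81 <= expR a * expR 16 by rewrite ler_pM2l.
have hs2 : expR a * expR 16 * (1 / 2) <= expR a * expR 16 * sin t.
  by rewrite ler_pM2l// mulr_gt0// expR_gt0.
apply: le_trans hs2; move: h81 e4 sc2 d1 t0 a12 ea; clear; lra.
Qed.

Definition rectangle x1 x2 y1 y2 : set (C R) :=
  [set z | [/\ x1 <= re z, re z <= x2, y1 <= im z & im z <= y2]].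

Lemma rectangle_compact x1 x2 y1 y2 : compact (rectangle x1 x2 y1 y2).
Proof.
rewrite (_ : rectangle _ _ _ _ =
    (fun p : R * R => (p.1 +i* p.2 : C R)) @` (`[x1, x2] `*` `[y1, y2])).
  apply: continuous_compact.
    apply: continuous_subspaceT => -[x y].
    by apply: (@cvgC _ _ (nbhs (x, y))) => /=; [exact: cvg_fst|exact: cvg_snd].
  by apply: compact_setX; exact: segment_compact.
apply/seteqP; split=> [z [h1 h2 h3 h4]|_ [[x y] /= [hx hy] <-]].
  by exists (re z, im z); rewrite /= ?re_im_eta ?in_itv/= ?h1 ?h2 ?h3 ?h4.
by move: hx hy; rewrite !in_itv/= => /andP[? ?] /andP[? ?]; split.
Qed.

Lemma rectangle_closed x1 x2 y1 y2 : closed (rectangle x1 x2 y1 y2).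
Proof. by apply: compact_closed; [exact: norm_hausdorff|exact: rectangle_compact]. Qed.

Lemma connected_component_segment (A : set (C R)) z w :
  (forall t, 0 <= t <= 1 -> A (((1 - t) * re z + t * re w) +i*
    ((1 - t) * im z + t * im w))) -> connected_component A z w.
Proof.
move=> h.
pose g t : C R := ((1 - t) * re z + t * re w) +i* ((1 - t) * im z + t * im w).
have -> : w = g 1 by rewrite /g subrr !mul0r !add0r !mul1r re_im_eta.
have {1}-> : z = g 0 by rewrite /g subr0 !mul0r !addr0 !mul1r re_im_eta.
apply: (@connected_component_path _ R); first exact: ler01.
move=> t t01; split; first exact: h.
apply: (@cvgC _ _ (nbhs t)) => /=; apply: cvgD; apply: cvgM;
  do ?[exact: cvg_cst|exact: cvg_id|apply: cvgB].
Qed.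

(** The width 16 is that of [dom_far], so no point of the domain lies to the left of the box. *)
Definition web_box n := rectangle (- S n - 16) (- S n) (- S n) (S n).

(* Conditions on the first k iterates: exp (-z) lands deep in the right half-plane,
   or f z lies on a level line, or f z belongs to the next arc. *)
Fixpoint web_arc n k : set (C R) :=
  web_box n `&` (if k is k'.+1 then
    [set z | [\/ 1 / 2 <= cos (im z), `|fatou_im z| = S n.+1 | web_arc n.+1 k' (f z)]]
  else setT).

Lemma web_arc_box n k : web_arc n k `<=` web_box n.
Proof. by case: k => [|k] z []. Qed.

Lemma web_arcS n k : web_arc n k.+1 `<=` web_arc n k.
Proof.
elim: k n => [|k ih] n z [zb h]; split=> //.
by case: h => h; [apply: Or31|apply: Or32|apply: Or33; exact: ih].
Qed.

Lemma web_arc_le n j k : (j <= k)%N -> web_arc n k `<=` web_arc n j.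
Proof.
by move=> /subnK <-; elim: (k - j)%N => // i ih z /web_arcS /ih.
Qed.

Lemma web_arc_closed n k : closed (web_arc n k).
Proof.
elim: k n => [|k ih] n.
  by rewrite /= setIT; exact: rectangle_closed.
apply: closedI; first exact: rectangle_closed.
rewrite (_ : mkset _ = [set z | 1 / 2 <= cos (im z)] `|` [set z | `|fatou_im z| = S n.+1]
  `|` f @^-1` web_arc n.+1 k); last first.
  apply/seteqP; split=> z; first by case; [left; left|left; right|right].
  by case=> [[h|h]|h]; [apply: Or31|apply: Or32|apply: Or33].
apply: closedU; last by apply: closed_comp => // z _; exact: continuous_fatou.
apply: closedU.
  apply: (@closed_comp _ _ (fun z : C R => cos (im z)) [set x | 1 / 2 <= x]).
    move=> z _; exact: (@cvg_comp _ _ _ (@complex.Im R : C R -> R) cos _ _ _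
      (@continuous_im R z) (@continuous_cos R (im z))).
  exact: closed_ge.
apply: (@closed_comp _ _ (fun z : C R => `|fatou_im z|) [set x | x = S n.+1]).
  by move=> z _; apply: (@cvg_norm _ _ _ (nbhs z)); exact: (@continuous_fatou_im R z).
exact: closed_eq.
Qed.

Lemma web_arc_fan n k z : web_box n z -> 1 / 2 <= cos (im z) -> web_arc n k z.
Proof. by move=> zb h; case: k => [|k]; split=> //; exact: Or31. Qed.

Lemma web_arc_escapes n z : (forall k, web_arc n k z) ->
  escapes (n%:R + m%:R) z.
Proof.
move=> zA j; elim: j n z zA => [|j ih] n z zA.
  have [h1 h2 _ _] := web_arc_box (zA 0%N).
  have [nS S12 _] := web_size_scale R m n.
  by apply: norm_ge_re; rewrite ler0_norm /=; lra.
have [h1 h2 h3 h4] := web_arc_box (zA 0%N).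
have [nS S12 _] := web_size_scale R m n.
have [nS' S12' _] := web_size_scale R m n.+1.
have n0 := ler0n R n; have m0 := ler0n R m.
have [cz|cz] := pselect (1 / 2 <= cos (im z)).
  by apply: escapes_fan => //; lra.
have [iz|iz] := pselect (`|fatou_im z| = S n.+1).
  apply: escapes_step; first by apply: norm_ge_re; rewrite ler0_norm /=; lra.
  have cS : cos (im (f z)) = 1.
    by rewrite im_fatou -cos_norm iz cos_web_size.
  by apply: escapes_line => //; rewrite ?im_fatou ?iz -?natr1 in nS' *; lra.
have zA' k : web_arc n.+1 k (f z) by have [_ []] := zA k.+1.
have := ih _ _ zA'; rewrite iterSr -(natr1 n) -(natr1 j).
by rewrite (_ : n%:R + 1 + m%:R + j%:R = n%:R + m%:R + (j%:R + 1))//; ring.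
Qed.

(** * Paths inside one arc *)

Section Cells.
Variables n k : nat.
Local Notation A := (web_arc n k.+1).
Local Notation cc := (connected_component A).

Definition web_point y : C R := (- S n) +i* y.

Lemma segment_fan z y : web_box n z -> - S n <= y <= S n ->
  (forall t, 0 <= t <= 1 -> 1 / 2 <= cos ((1 - t) * im z + t * y)) ->
  cc z (web_point y).
Proof.
move=> [h1 h2 h3 h4] /andP[y1 y2] h; apply: connected_component_segment => t t01.
apply: web_arc_fan; last exact: h.
by move: t01 => /andP[t0 t1]; split=> /=; nra.
Qed.

(** The cosine grows monotonically from distance 0 to distance pi from the centre, so the straight
    segment stays where it is at least 1/2. The sign [e] selects the upper or lower end of the
    cell. *)
Lemma fan_connected c e z : e = 1 \/ e = -1 -> cos c = -1 -> `|c| + pi <= S n ->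
  web_box n z -> 0 <= e * (im z - c) <= pi -> 1 / 2 <= cos (im z) ->
  cc z (web_point (c + e * pi)).
Proof.
move=> e1 cc1 cS zb; set s := e * (im z - c) => /andP[s0 sp] cz.
have e2 : e * e = 1 by case: e1 => ->; ring.
have iz : im z = c + e * s by rewrite /s mulrA e2; ring.
have p0 := pi_gt0 R.
have cosE t : cos (c + e * t) = - cos t.
  by rewrite cosD_center//; case: e1 => ->; rewrite ?mul1r// mulN1r cosN.
apply: segment_fan => //.
  move: cS; rewrite -lerBrDr ler_norml => /andP[c1 c2].
  by case: e1 => ->; apply/andP; split; lra.
move=> t /andP[t0 t1].
rewrite (_ : (1 - t) * im z + t * (c + e * pi) = c + e * ((1 - t) * s + t * pi));
  last by rewrite iz; ring.
move: cz; rewrite iz !cosE => cz; apply: (le_trans cz); rewrite lerN2.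
by apply: cos_anti; nra.
Qed.

(* The level curve Im (f z) = e S_(n+1) is the graph of an explicit function of Im z. *)
Lemma curve_connected c e z : e = 1 \/ e = -1 -> cos c = -1 -> `|c| + pi <= S n ->
  A z -> `|im z - c| <= pi -> fatou_im z = e * S n.+1 -> cc z (web_point (c + e * pi)).
Proof.
move=> e1 cc1 cS zA; have zb := web_arc_box zA.
have sc := web_size_scaleS R m n; have p0 := pi_gt0 R.
have scg := scale_gt sc; have [S12 _ _] := sc.
have pa : pi <= S n by apply: le_trans cS; rewrite lerDr.
have en t : `|e * t| = `|t| by rewrite normrM; case: e1 => ->; rewrite ?normrN normr1 mul1r.
have e2 : e * e = 1 by case: e1 => ->; rewrite ?mulrNN mulr1.
set s := e * (im z - c) => zc zf.
have iz : im z = c + e * s by rewrite /s mulrA e2 mul1r addrC subrK.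
have cosE t : cos (c + e * t) = - cos t.
  by rewrite cosD_center//; case: e1 => ->; rewrite ?mul1r// mulN1r cosN.
have sinE t : sin (c + e * t) = - (e * sin t).
  by rewrite sinD_center//; case: e1 => ->; rewrite ?mul1r// !mulN1r sinN.
have /andP[ec1 ec2] : - S n <= e * c <= S n.
  by rewrite -ler_norml en (le_trans _ cS)// lerDl ltW.
have /andP[sp1 sp2] : - pi <= s <= pi by rewrite -ler_norml en.
have u0 : 0 < expR (- re z) := expR_gt0 _.
have zs : expR (- re z) * sin s = S n.+1 - s - e * c.
  move: zf; rewrite /fatou_im iz sinE => zf.
  have -> : S n.+1 = e * (e * S n.+1) by rewrite mulrA e2 mul1r.
  rewrite -zf -[in LHS](mul1r (_ * sin s)) -[s in _ - s - _]mul1r -e2.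
  by clear; ring.
have bs : 0 < S n.+1 - s - e * c by move: S12 scg pa sp2 ec2; clear; lra.
have ss : 0 < sin s by rewrite -(pmulr_rgt0 _ u0) zs.
have s0 : 0 < s.
  rewrite ltNge; apply/negP => s0; have : 0 <= sin (- s).
    by apply: sin_ge0_pi; rewrite oppr_ge0 s0 lerNl.
  by rewrite sinN oppr_ge0 leNgt ss.
have [cz|cz] := leP (1 / 2) (cos (im z)).
  by apply: fan_connected => //; rewrite -/s ltW.
(* At distance 2 pi / 3 from the centre the cosine of the height reaches 1/2: the level curve is
   followed up to there, then [fan_connected] finishes. *)
pose s1 : R := acos (- (1 / 2)).
have ss1 : s <= s1.
  rewrite leNgt; apply/negP => /ltW h; have := cos_anti acosN2_ge0 h sp2.
  by move: cz; rewrite iz cosE cos_acosN2; clear; lra.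
pose q t := (S n.+1 - t - e * c) / sin t.
pose g t : C R := (- ln (q t)) +i* (c + e * t).
have gE t : re (g t) = - ln (q t) /\ im (g t) = c + e * t by [].
have st t : s <= t <= s1 -> 0 < sin t.
  move=> /andP[t0 t1]; apply: sin_gt0_pi.
  by rewrite (lt_le_trans s0 t0) (le_lt_trans t1 acosN2_ltpi).
have [zb1 zb2 _ _] := zb.
have qb t : s <= t <= s1 -> expR (S n) <= q t <= expR (S n + 16).
  move=> /andP[t0 t1].
  by apply: (curve_quotient sc ec1 ec2 s0 t0 t1 zs); rewrite lerNl opprD.
have q_pos t : s <= t <= s1 -> 0 < q t.
  by move=> /qb/andP[h _]; apply: lt_le_trans h; exact: expR_gt0.
have expg t : s <= t <= s1 -> expR (- re (g t)) = q t.
  by move=> h; rewrite /= opprK lnK ?posrE ?q_pos.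
have ga t : s <= t <= s1 -> A (g t).
  move=> h; have /andP[q1 q2] := qb t h; have eg := expg t h.
  have /andP[i1 i2] : - S n <= im (g t) <= S n.
    rewrite -ler_norml /= (le_trans (ler_normD _ _))// en; apply: le_trans cS.
    move: h => /andP[t0 t1]; rewrite lerD2l gtr0_norm ?(lt_le_trans s0)//.
    exact: le_trans t1 (ltW acosN2_ltpi).
  split; [split=> //|].
  - by rewrite -opprD lerNl -ler_expR eg.
  - by rewrite lerNr -ler_expR eg.
  apply: Or32; rewrite /fatou_im eg (gE t).2 sinE.
  have qs : q t * sin t = S n.+1 - t - e * c by rewrite divfK// gt_eqF// st.
  have -> : c + e * t - q t * - (e * sin t) = c + e * t + e * (q t * sin t).
    by clear; ring.
  rewrite qs.
  have -> : c + e * t + e * (S n.+1 - t - e * c) = e * S n.+1 + c * (1 - e * e).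
    by clear; ring.
  by rewrite e2 subrr mulr0 addr0 en ger0_norm// ltW// (web_size_gt0 R m n.+1).
have gz : z = g s.
  have -> : g s = re z +i* im z; last by rewrite re_im_eta.
  rewrite /g iz; congr (_ +i* _); rewrite /q -zs mulfK ?gt_eqF//.
  by rewrite expRK opprK.
apply: (@connected_component_trans _ _ (g s1)); last first.
  apply: fan_connected => //.
  - by apply: web_arc_box; apply: ga; rewrite ss1 lexx.
  - have -> : e * (im (g s1) - c) = s1.
      by rewrite (gE s1).2 addrAC subrr add0r mulrA e2 mul1r.
    by rewrite acosN2_ge0 ltW// acosN2_ltpi.
  by rewrite /= cosE cos_acosN2 opprK.
rewrite {1}gz; apply: (@connected_component_path _ R) => // t h.
split; first exact: ga.
apply: (@cvgC _ _ (nbhs t)) => /=.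
  apply: cvgN; apply: continuous_cvg; first by apply: continuous_ln; exact: q_pos.
  apply: cvgM.
    by apply: cvgB; [apply: cvgB; [exact: cvg_cst|exact: cvg_id]|exact: cvg_cst].
  by apply: cvgV; [rewrite gt_eqF// st|exact: continuous_sin].
by apply: cvgD; [exact: cvg_cst|apply: cvgM; [exact: cvg_cst|exact: cvg_id]].
Qed.

End Cells.
End WebArcs.

(** * The web *)

Section Web.
Variables (R : realType) (m : nat).
Implicit Types (x y s t a b c e r : R) (z w : C R).
Local Notation S := (web_size R m).
Local Notation f := (@fatou_map R).
Local Notation web_arc := (@web_arc R m).
Local Notation web_box := (@web_box R m).
Local Notation web_point := (@web_point R m).
Local Notation web_dom := (@web_dom R m).

Lemma web_box_strip n z : cos (im z) <= 0 -> `|im z| <= S n ->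
  web_box n.+1 (f z) -> web_box n z.
Proof.
move=> cz iz [h1 h2 h3 h4].
have zS : re z < - S n.
  by apply: (re_lt_left (web_size_scaleS R m n)); rewrite -re_fatou.
move: iz; rewrite ler_norml => /andP[i1 i2]; split=> //; last exact: ltW.
rewrite leNgt; apply/negP => zfar.
have iz : `|im z| <= S n by rewrite ler_norml i1.
have := fatou_far (web_size_scaleS R m n) (ltW zfar) iz.
rewrite -re_fatou -im_fatou => -[|]; rewrite ltr_normr => /orP[]; lra.
Qed.

(** * The inverse image of the next arc in one strip *)

Section Step.
Variables n k : nat.
Hypothesis ih : connected (web_arc n.+1 k).
Local Notation A := (web_arc n k.+1).
Local Notation cc := (connected_component A).
Variable c : R.
Hypotheses (cc1 : cos c = -1) (cS : `|c| + pi <= S n).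

Lemma arc_lift w : web_arc n.+1 k w ->
  [/\ in_strip c (strip_inv c w), f (strip_inv c w) = w & A (strip_inv c w)].
Proof.
move=> wA; have wb := web_arc_box wA; have [w1 w2 w3 w4] := wb.
have [] := @strip_invP R (S n.+1) c w (ltW (web_size_gt0 R m n.+1)) cc1 _ w2 _.
- apply: (@le_trans _ _ (S n)); last by have := web_size_ltS R m n; lra.
  by apply: le_trans cS; rewrite lerDl pi_ge0.
- by rewrite ler_norml w3.
move=> h1 h2; split=> //; split; last by apply: Or33; rewrite h2.
apply: web_box_strip; last by rewrite h2.
  have -> : im (strip_inv c w) = c + (im (strip_inv c w) - c) by ring.
  rewrite cosD_center// oppr_le0; apply: cos_ge0_pihalf.
  by rewrite -ler_norml.
exact/ltW/(im_strip cS).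
Qed.

(** The inverse image of the next arc is connected and contains the preimage of the corner [v]. That
    preimage lies on a level curve, which leads to the end of the cell. *)
Lemma arc_lift_connected e w : e = 1 \/ e = -1 -> web_arc n.+1 k w ->
  cc (strip_inv c w) (web_point n (c + e * pi)).
Proof.
move=> e1 wA; have p0 := pi_gt0 R; have S0 := web_size_gt0 R m n.+1.
pose v : C R := (- S n.+1) +i* (e * S n.+1).
have vA : web_arc n.+1 k v.
  apply: web_arc_fan.
    by split=> /=; try lra; case: e1 => ->; lra.
  have -> : cos (im v) = 1; last lra.
  by rewrite /v /=; case: e1 => ->; rewrite ?mul1r ?mulN1r ?cosN cos_web_size.
have [v1 v2 v3] := arc_lift vA.
apply: (@connected_component_trans _ _ (strip_inv c v)); last first.
  apply: curve_connected => //; last by rewrite -im_fatou v2.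
  by apply: (le_trans v1); lra.
exists (strip_inv c @` web_arc n.+1 k); last by exists v.
split; first by exists w.
  by move=> _ [u uA <-]; case: (arc_lift uA).
apply: connected_continuous_connected => //.
apply/subspace_continuousP => u uA.
have FF : Filter (within (web_arc n.+1 k) (nbhs u)) by exact: within_filter.
apply: (@cvg_dominated R (C R) _ FF (strip_inv c) id (strip_inv c u) u).
  apply: (@filterS _ _ FF (web_arc n.+1 k)); last exact: withinT.
  move=> q qA.
  have [u1 u2 _] := arc_lift uA; have [q1 q2 _] := arc_lift qA.
  by rewrite -{2}u2 -{2}q2; exact: (fatou_strip_expand cc1).
by apply: cvg_within_filter; exact: cvg_id.
Qed.

End Step.

(** Induction on [k] for all levels. In each cell the inverse image of the next arc links the two
    ends, so the points at heights [2 pi j] on the left edge are chained together; any other point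
    reaches an end of its cell, with one case for each clause of [web_arc]. *)
Lemma web_arc_connected n k : connected (web_arc n k).
Proof.
have p0 := pi_gt0 R.
elim: k n => [|k ih] n; have S12 := web_size_ge12 R m n.
  have b0 : web_arc n 0 (web_point n 0) by split=> //; split=> /=; lra.
  apply: (connected_from b0) => z [[h1 h2 h3 h4] _].
  apply: connected_component_sym.
  apply: connected_component_segment => t /andP[t0 t1] /=.
  by split=> //; split=> /=; nra.
set A := web_arc n k.+1; set cc := connected_component A.
have e1 : (1 : R) = 1 \/ (1 : R) = -1 by left.
have em1 : (-1 : R) = 1 \/ (-1 : R) = -1 by right.
have cell c : cos c = -1 -> `|c| + pi <= S n ->
    cc (web_point n (c - pi)) (web_point n (c + pi)).
  move=> c1 cS; pose v : C R := (- S n.+1) +i* S n.+1.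
  have S0 := web_size_gt0 R m n.+1.
  have vA : web_arc n.+1 k v.
    by apply: web_arc_fan; [split=> /=; lra|rewrite cos_web_size; lra].
  have := arc_lift_connected (ih n.+1) c1 cS e1 vA.
  have := arc_lift_connected (ih n.+1) c1 cS em1 vA.
  rewrite mul1r mulN1r => /connected_component_sym h1 h2.
  exact: connected_component_trans h1 h2.
have center i : (i < web_index R m n)%N ->
    cos (2 * pi * i%:R + pi) = -1 :> R /\ `|2 * pi * i%:R + pi| + pi <= S n.
  move=> iN; split; first exact: cos_odd_pi.
  rewrite ger0_norm; last by rewrite addr_ge0 ?mulr_ge0 ?ler0n// ltW.
  have : i.+1%:R <= (web_index R m n)%:R :> R by rewrite ler_nat.
  by rewrite /web_size -natr1; nra.
have b0 : A (web_point n 0).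
  by apply: web_arc_fan; [split=> /=; lra|rewrite cos0; lra].
have ends i : (i <= web_index R m n)%N ->
    cc (web_point n 0) (web_point n (2 * pi * i%:R)) /\
    cc (web_point n 0) (web_point n (- (2 * pi * i%:R))).
  elim: i => [_|i ihi iN].
    by rewrite mulr0 oppr0; split; exact: connected_component_refl.
  have [h1 h2] := ihi (ltnW iN); have [c1 cS] := center i iN.
  have := cell _ c1 cS; have := cell (- (2 * pi * i%:R + pi)).
  rewrite cosN normrN => /(_ c1 cS).
  have -> : - (2 * pi * i%:R + pi) - pi = - (2 * pi * i.+1%:R) :> R.
    by rewrite -natr1; ring.
  have -> : - (2 * pi * i%:R + pi) + pi = - (2 * pi * i%:R) :> R by ring.
  have -> : 2 * pi * i%:R + pi + pi = 2 * pi * i.+1%:R :> R.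
    by rewrite -natr1; ring.
  rewrite addrK => /connected_component_sym g2 g1.
  by split; [exact: connected_component_trans h1 g1|exact: connected_component_trans h2 g2].
apply: (connected_from b0) => z zA.
have zb := web_arc_box zA; have [z1 z2 z3 z4] := zb.
have iz : `|im z| <= S n by rewrite ler_norml z3.
have [i [iN [c [ec zc]]]] := center_near (web_index_gt0 R m n) iz.
have [c1 cS] : cos c = -1 /\ `|c| + pi <= S n.
  by have [? ?] := center i iN; case: ec => ->; rewrite ?cosN ?normrN.
have pt e : e = 1 \/ e = -1 -> cc (web_point n 0) (web_point n (c + e * pi)).
  have [h1 h2] := ends i (ltnW iN); have [h3 h4] := ends i.+1 iN.
  have eS : 2 * pi * i.+1%:R = 2 * pi * i%:R + pi + pi :> R by rewrite -natr1; ring.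
  case: ec => ->; case=> ->; rewrite ?mul1r ?mulN1r.
  - by rewrite -eS.
  - by rewrite addrK.
  - by rewrite (_ : _ + _ = - (2 * pi * i%:R))//; ring.
  - by rewrite (_ : _ - _ = - (2 * pi * i.+1%:R))// eS; ring.
suff [e ee h] : exists2 e, e = 1 \/ e = -1 & cc z (web_point n (c + e * pi)).
  exact: connected_component_trans (pt e ee) (connected_component_sym h).
have [_ [h|h|h]] := zA.
- have [s|s] := leP 0 (im z - c).
    exists 1 => //; apply: fan_connected => //.
    by rewrite mul1r s; move: zc; rewrite ger0_norm.
  exists (-1) => //; apply: fan_connected => //.
  by rewrite mulN1r oppr_ge0 (ltW s); move: zc; rewrite ltr0_norm.
- have [s|s] := leP 0 (fatou_im z).
    exists 1 => //; apply: curve_connected => //.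
    by rewrite mul1r -h ger0_norm.
  exists (-1) => //; apply: curve_connected => //.
  by rewrite mulN1r -h ltr0_norm// opprK.
exists 1 => //; have [f1 f2 f3 f4] := web_arc_box h.
have cz : cos (im z) < 0.
  by apply: (cos_lt0_left (web_size_scaleS R m n)); rewrite -?re_fatou.
have zs : in_strip c z.
  apply: cos_ge0_abs => //; move: cz; have {1}-> : im z = c + (im z - c) by ring.
  by rewrite cosD_center// oppr_lt0 => /ltW.
by rewrite -(strip_invK c1 zs); exact: arc_lift_connected.
Qed.

Lemma web_dom_closure n z : closure (web_dom n) z ->
  [/\ - S n - 16 <= re z, re z <= S n & `|im z| <= S n].
Proof.
move=> zc; suff : rectangle (- S n - 16) (S n) (- S n) (S n) z.
  by move=> [h1 h2 h3 h4]; split=> //; rewrite ler_norml h3.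
have /closure_id -> := @rectangle_closed R (- S n - 16) (S n) (- S n) (S n).
apply: closureS zc => w [k _ wk]; have := dom_im wk; rewrite ltr_norml.
move=> /andP[i1 i2]; split; [exact/ltW/dom_far/wk|exact/ltW/dom_re/wk|exact: ltW|exact: ltW].
Qed.

(** A boundary point strictly left of the square is mapped to the boundary of the next domain. An
    image on the horizontal edges or on the right edge gives the level-curve or the fan clause;
    otherwise the induction continues. *)
Lemma boundary_web_dom n k z : closure (web_dom n) z -> ~ web_dom n z ->
  [\/ `|im z| = S n, re z = S n | web_arc n k z].
Proof.
elim: k n z => [|k ih] n z zc zn; have [r1 r2 i1] := web_dom_closure zc;
  have [?|iz] := eqVneq `|im z| (S n); try exact: Or31;
  have [?|rz] := eqVneq (re z) (S n); try exact: Or32; apply: Or33;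
  have {}iz : `|im z| < S n by [rewrite lt_neqAle iz];
  have {}rz : re z < S n by [rewrite lt_neqAle rz];
  (have zS : re z < - S n by
    rewrite ltNge; apply/negP => zS; apply: zn; exists 1%N => //;
    exact: dom_left_edge);
  have zb : web_box n z by
    [move: i1; rewrite ler_norml => /andP[? ?]; split=> //; exact: ltW].
  by split.
split=> //.
have fzn : ~ web_dom n.+1 (f z).
  by move=> [j _ fj]; apply: zn; exists j.+1 => //; split=> //; right.
have fzc : closure (web_dom n.+1) (f z).
  move=> B fB.
  (* Requiring [re w < - S n] excludes the square clause of [dom], so membership of [w] must come
     from its image. *)
  have zB : nbhs z (f @^-1` B `&` [set w | re w < - S n]).
    apply: filterI; first exact: (@continuous_fatou R z).
    by apply: (@near_lt R _ (nbhs z) _ (@complex.Re R)) zS; exact: continuous_re.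
  have [w [[j _ wj] [wB wS]]] := zc _ zB.
  exists (f w); split=> //.
  case: j wj => [[_ _]|j [_ _ []]]; rewrite /= in wS *; try by rewrite ltNge ltW.
  by exists j.
have [h1 h2 h3] := web_dom_closure fzc.
have [h|h|h] := ih _ _ fzc fzn.
- by apply: Or32; rewrite -im_fatou.
- apply: Or31; apply: (cos_ge_right (web_size_scaleS R m n)).
  + exact: ltW.
  + exact: ltW.
  + by rewrite -re_fatou h.
  + by rewrite -im_fatou.
- exact: Or33.
Qed.

(** The half-plane and the lines are taken whole, beyond the edges of the squares: every line meets
    the half-plane, which ties all levels together. *)
Definition web : set (C R) :=
  [set z | S 0%N <= re z] `|` \bigcup_n [set z | `|im z| = S n]
  `|` \bigcup_n \bigcap_k web_arc n k.

Lemma escapes_le a b z : a <= b -> escapes b z -> escapes a z.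
Proof.
move=> ab h k; apply: le_trans (h k); rewrite lecR.
by rewrite ler_pM2r ?invr_gt0// lerD2r.
Qed.

Lemma web_escapes z : web z -> escapes m%:R z.
Proof.
have m0 := ler0n R m.
case=> [[zr|[n _ zi]]|[n _ zA]].
- have [h1 h2 _] := web_size_scale R m 0; rewrite /= in zr.
  by apply: escapes_right; lra.
- have [h1 h2 _] := web_size_scale R m n; have n0 := ler0n R n.
  apply: escapes_line => //; first by rewrite zi; lra.
  by rewrite -cos_norm zi cos_web_size.
- apply: (@escapes_le _ (n%:R + m%:R)); first by rewrite lerDr ler0n.
  by apply: web_arc_escapes => k; exact: zA.
Qed.

Lemma web_size_ge_first n : S 0%N <= S n.
Proof.
by elim: n => // n ih; apply: (le_trans ih); have := web_size_ltS R m n; lra.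
Qed.

Lemma web_connected : connected web.
Proof.
have S0 := web_size_gt0 R m.
have b0 : web ((S 0%N) +i* 0) by left; left => /=.
have right_part z : S 0%N <= re z -> connected_component web z ((S 0%N) +i* 0).
  move=> zr; apply: connected_component_segment => t /andP[t0 t1] /=.
  by left; left => /=; nra.
have line z n : `|im z| = S n -> connected_component web z ((S 0%N) +i* 0).
  move=> zi; pose p : C R := (S 0%N) +i* im z.
  apply: (@connected_component_trans _ _ p).
    apply: connected_component_segment => t /andP[t0 t1] /=.
    by left; right; exists n => //=; rewrite -zi -mulrDl subrK mul1r.
  exact: right_part.
apply: (connected_from b0) => z [[zr|[n _ zi]]|[n _ zA]].
- exact/connected_component_sym/right_part.
- exact/connected_component_sym/(line _ n).
apply: connected_component_sym.
(* This corner has cosine 1, so it belongs to every arc of level [n], and it also lies on a line of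
   the web. *)
pose p : C R := (- S n) +i* S n.
apply: (@connected_component_trans _ _ p); last first.
  by apply: (line _ n); rewrite /= ger0_norm// ltW.
exists (\bigcap_k web_arc n k); last first.
  move=> k _; apply: web_arc_fan; last by rewrite /= cos_web_size; lra.
  by have := S0 n; split=> /=; lra.
split=> //; first by move=> w wA; right; exists n.
(* The box is enlarged by 1 on each side so that the arcs lie in the interior of a compact set. *)
apply: (@connected_bigcap _ (rectangle (- S n - 17) (- S n + 1) (- S n - 1) (S n + 1))).
- exact: norm_hausdorff.
- exact: rectangle_compact.
- move=> k w /web_arc_box[w1 w2 w3 w4].
  have wr := @continuous_re R w; have wi := @continuous_im R w.
  have n1 : \forall q \near w, - S n - 17 < re q.
    by apply: (near_gt _ wr); lra.
  have n2 : \forall q \near w, re q < - S n + 1.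
    by apply: (near_lt _ wr); lra.
  have n3 : \forall q \near w, - S n - 1 < im q.
    by apply: (near_gt _ wi); lra.
  have n4 : \forall q \near w, im q < S n + 1.
    by apply: (near_lt _ wi); lra.
  rewrite /interior /=; near=> q.
  by split; apply: ltW; near: q.
- by move=> k; exact: web_arc_closed.
- by move=> i j; exact: web_arc_le.
- by move=> k; exact: web_arc_connected.
Unshelve. all: by end_near. Qed.

Lemma web_spiders_web : spiders_web web.
Proof.
split; first exact: web_connected.
exists web_dom; split.
- move=> n; split; first exact: web_dom_bounded.
  exact: web_dom_simply_connected.
- by move=> n; exact: web_domS.
- move=> n z [zc zi]; have zn : ~ web_dom n z.
    by have := @web_dom_open R m n; rewrite openE => /(_ z) h /h.
  have [{}zi|{}zi] := pselect (`|im z| = S n).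
    by left; right; exists n.
  have [zr|zr] := pselect (re z = S n).
    by left; left; rewrite /= zr web_size_ge_first.
  right; exists n => // k _.
  by case: (boundary_web_dom k zc zn).
- exact: bigcup_web_dom.
Qed.

End Web.

Theorem theorem1p2 (R : realType) (m : nat) (hm : (0 < m)%N) :
  contains_spiders_web
    (escaping_set_at_rate (@fatou_map R) (fun n : nat => (n + m)%:R / 2)).
Proof.
exists (@web R m); split; last exact: web_spiders_web.
by move=> z /web_escapes h n _; rewrite natrD addrC.
Qed.
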